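(* For $m$-almost every $\omega\in\Omega$ there exists a subset $Q_\omega\subset Q$ of full Lebesgue measure such that for all $z\in Q_\omega$ the following holds. For every $\delta>0$ there exist $n_z(\delta)\in\mathbb N$ and integers $k_n(z)\ge0$, $n\ge n_z(\delta)$, such that for every $n\ge n_z(\delta)$, with $k=k_n(z)$, $$|F^n_\omega(z)-F^k_{\theta^{n-k}\omega}(0)|<\delta\quad\text{or}\quad|F^n_\omega(z)|\ge1/\delta.$$ In addition, $\limsup_{n\to\infty}k_n(z)=+\infty$.
   Context: Setting. $(\Omega,\mathcal F,m)$ is a complete probability space; $\theta:\Omega\to\Omega$ is an invertible measurable map with measurable inverse, preserving $m$ and ergodic with respect to $m$. Real constants $B>A>1/e$ are fixed, and $\eta:\Omega\to[A,B]$ is measurable. For $\omega\in\Omega$ put $f_\omega(z)=\eta(\omega)e^z$, $f_\omega:\mathbb C\to\mathbb C$. Let $Q=\mathbb C/2\pi i\mathbb Z$ be the cylinder with quotient map $\pi:\mathbb C\to Q$ and the quotient Euclidean metric; for $z\in Q$, $|z|:=\inf\{|Z|:Z\in\pi^{-1}(z)\}$, $|z-w|$ denotes the distance in $Q$, and $0\in Q$ denotes $\pi(0)$. Since $f_\omega$ is $2\pi i$-periodic, $\pi\circ f_\omega$ descends to a holomorphic map $F_\omega:Q\to Q$. For $n\ge 0$ put $F_\omega^n:=F_{\theta^{n-1}\omega}\circ\cdots\circ F_{\theta\omega}\circ F_\omega$ ($F^0_\omega=\mathrm{id}$). *)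

(* Defs.v *)
From HB Require Import structures.
From mathcomp Require Export all_boot all_order all_algebra.
From mathcomp Require Export generic_quotient ring_quotient complex.
From mathcomp Require Export all_classical all_reals all_analysis.

Set Implicit Arguments.
Unset Strict Implicit.
Unset Printing Implicit Defensive.

Import Order.TTheory GRing.Theory Num.Theory.
Import numFieldNormedType.Exports.

Local Open Scope classical_set_scope.
Local Open Scope ring_scope.
Local Open Scope quotient_scope.

Section Cylinder.
Variable R : realType.

Definition cexp (z : R[i]) : R[i] :=
  real_complex R (expR (complex.Re z)) * Complex (cos (complex.Im z)) (sin (complex.Im z)).

Definition twopi_i : R[i] := Complex 0 (pi *+ 2).

Definition period_lattice : {pred R[i]} :=
  fun z => `[< exists n : int, z = twopi_i *~ n >].

Lemma period_lattice_zmod_closed : zmod_closed period_lattice.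
Proof.
split; first by apply/asboolP; exists 0.
move=> x y /asboolP[n ->] /asboolP[p ->]; apply/asboolP; exists (n - p).
by rewrite mulrzBr.
Qed.

HB.instance Definition _ :=
  GRing.isZmodClosed.Build R[i] period_lattice period_lattice_zmod_closed.

(* The additive group C / 2 pi i Z; [\pi_cylinder] is the quotient map. *)
Definition cylinder : Type := Quotient.quot period_lattice.
HB.instance Definition _ := GRing.Zmodule.on cylinder.
HB.instance Definition _ := EqQuotient.on cylinder.
HB.instance Definition _ := isPointed.Build cylinder 0.

Lemma eq_cylinderP (z w : R[i]) :
  \pi_cylinder z = \pi_cylinder w <-> exists n : int, z = w + twopi_i *~ n.
Proof.
have E : (z - w \in period_lattice) = (z == w %[mod cylinder]).
  exact: (Quotient.idealrBE period_lattice z w).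
split.
  move=> /eqP zw; have /asboolP[n zwn] : z - w \in period_lattice by rewrite E.
  by exists n; rewrite -zwn addrC subrK.
move=> [n ->]; apply/eqP; rewrite -(Quotient.idealrBE period_lattice).
by apply/asboolP; exists n; rewrite addrAC subrr add0r.
Qed.

Definition cyl_norm (q : cylinder) : R :=
  inf [set r | exists2 Z : R[i], \pi_cylinder Z = q & r = Normc.normc Z].

Definition cyl_dist (q p : cylinder) : R :=
  inf [set r | exists Z W : R[i],
    [/\ \pi_cylinder Z = q, \pi_cylinder W = p & r = Normc.normc (Z - W)]].

Lemma pi_cylinderD (z w : R[i]) :
  \pi_cylinder (z + w) = \pi_cylinder z + \pi_cylinder w.
Proof. exact: (@Quotient.pi_add _ period_lattice). Qed.

Lemma pi_cylinderB (z w : R[i]) :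
  \pi_cylinder (z - w) = \pi_cylinder z - \pi_cylinder w.
Proof.
by rewrite pi_cylinderD; congr (_ + _); exact: (@Quotient.pi_opp _ period_lattice).
Qed.

Lemma cyl_distE (q p : cylinder) : cyl_dist q p = cyl_norm (q - p).
Proof.
congr inf; apply/seteqP; split=> r /=.
  by move=> [Z [W [<- <- ->]]]; exists (Z - W) => //; exact: pi_cylinderB.
move=> [Z Zqp ->]; exists (Z + repr p), (repr p); split; last by rewrite addrK.
- by rewrite pi_cylinderD Zqp reprK subrK.
- by rewrite reprK.
Qed.

Definition exp_map (a : R) (z : R[i]) : R[i] := real_complex R a * cexp z.

(* [lift_op1] applies [exp_map a] to a representative; [cyl_map_pi] below
   shows that the result does not depend on its choice. *)
Definition cyl_map (a : R) : cylinder -> cylinder :=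
  lift_op1 cylinder (exp_map a).

Lemma cexp_periodic (z : R[i]) (n : int) : cexp (z + twopi_i *~ n) = cexp z.
Proof.
have step w : cexp (w + twopi_i) = cexp w.
  by case: w => x y; rewrite /cexp /= addr0 cosD2pi sinD2pi.
have stepn w (k : nat) : cexp (w + twopi_i *+ k) = cexp w.
  elim: k => [|k IH]; first by rewrite mulr0n addr0.
  by rewrite mulrSr addrA step.
case: n => k; first exact: stepn.
by rewrite NegzE mulrNz -[in RHS](subrK (twopi_i *~ k.+1) z) stepn.
Qed.

Lemma cyl_map_pi (a : R) (z : R[i]) :
  cyl_map a (\pi_cylinder z) = \pi_cylinder (exp_map a z).
Proof.
rewrite /cyl_map; unlock; congr (\pi_cylinder _).
have [n ->] : exists n : int, repr (\pi_cylinder z) = z + twopi_i *~ n.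
  by apply/eq_cylinderP; rewrite reprK.
by rewrite /exp_map cexp_periodic.
Qed.

Definition cyl_proj (xy : measurableTypeR R * measurableTypeR R) : cylinder :=
  \pi_cylinder (Complex xy.1 xy.2).

(* A set is measurable in the cylinder when its preimage in the plane is Borel:
   this is the Borel sigma-algebra of the cylinder, since the quotient map is
   a local homeomorphism. *)
Definition cyl_measurable : set (set cylinder) :=
  [set A | measurable (cyl_proj @^-1` A)].

Lemma cyl_measurable0 : cyl_measurable set0.
Proof. by rewrite /cyl_measurable /= preimage_set0. Qed.

Lemma cyl_measurableC A : cyl_measurable A -> cyl_measurable (~` A).
Proof. by rewrite /cyl_measurable /= -preimage_setC => /measurableC. Qed.

Lemma cyl_measurable_bigcup (F : (set cylinder)^nat) :
  (forall i, cyl_measurable (F i)) -> cyl_measurable (\bigcup_i F i).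
Proof.
move=> mF; rewrite /cyl_measurable /= preimage_bigcup.
by apply: bigcup_measurable => i _; exact: mF.
Qed.

HB.instance Definition _ := @isMeasurable.Build default_measure_display cylinder
  cyl_measurable cyl_measurable0 cyl_measurableC cyl_measurable_bigcup.

Lemma measurable_cyl_proj : measurable_fun [set: _] cyl_proj.
Proof. by move=> _ A mA; rewrite setTI. Qed.

Definition strip : set (measurableTypeR R * measurableTypeR R) :=
  [set: measurableTypeR R] `*` `[0, pi *+ 2[.

Lemma measurable_strip : measurable strip.
Proof. by apply: measurableX => //; exact: measurable_itv. Qed.

(* The strip is a fundamental domain of the quotient, so that pushing forward
   planar Lebesgue measure restricted to it gives the area on the cylinder. *)
Definition cyl_lebesgue : set cylinder -> \bar R :=
  pushforward
    (mrestr (lebesgue_measure \x lebesgue_measure)%E measurable_strip) cyl_proj.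

(* The instance of [pushforward] depends on the measurability of the map. *)
Let cyl_lebesgue_measure : {measure set cylinder -> \bar R} :=
  measure_function_pushforward__canonical__measure_function_Measure
    (mrestr (lebesgue_measure \x lebesgue_measure)%E measurable_strip)
    measurable_cyl_proj.

HB.instance Definition _ := Measure.copy cyl_lebesgue cyl_lebesgue_measure.

End Cylinder.

Section RandomIteration.
Variables (R : realType) (Omega : Type) (theta : Omega -> Omega).

Definition int_iter (theta_inv : Omega -> Omega) (n : int) (w : Omega) : Omega :=
  match n with
  | Posz p => iter p theta w
  | Negz p => iter p.+1 theta_inv w
  end.

Fixpoint random_iter (eta : Omega -> R) (w : Omega) (n : nat)
    (q : cylinder R) : cylinder R :=
  if n is p.+1 then cyl_map (eta (iter p theta w)) (random_iter eta w p q)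
  else q.

End RandomIteration.

Section Ergodicity.
Context d (Omega : measurableType d) (R : realType).
Variables (m : set Omega -> \bar R) (theta : Omega -> Omega).

Definition measure_preserving : Prop :=
  forall A, measurable A -> m (theta @^-1` A) = m A.

Definition ergodic : Prop :=
  forall A, measurable A -> theta @^-1` A = A -> m A = 0%E \/ m A = 1%E.

End Ergodicity.

(* Main.v *)
Require Import Defs.
From mathcomp Require Import all_boot all_order all_algebra.
From mathcomp Require Import all_classical all_reals all_analysis.
From mathcomp Require Import measurable_realfun.
From mathcomp Require Import ring lra zify.

Set Implicit Arguments.
Unset Strict Implicit.
Unset Printing Implicit Defensive.

Import Order.TTheory GRing.Theory Num.Theory.
Import numFieldNormedType.Exports.

Local Open Scope classical_set_scope.
Local Open Scope ring_scope.

(** The argument is deterministic: it applies to every sequence [a n] in [[A, B]]. Write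
    [u_n] for the orbit of [z] in the plane, [x_n + i y_n] for its coordinates and [D_n]
    for the modulus of the derivative of the n-th iterate. Since [f' = f], a perturbation
    [h_n] of [u_n] evolves by [h_(n+1) = u_(n+1) (e^(h_n) - 1)], so the n-th iterate has
    bounded distortion at scale [r] as soon as [r (D_0 + ... + D_(n-1))] is small. The
    identity [|y_(n+1)| = |u_(n+1)| |sin y_n|] together with [A > 1/e] shows that
    [|y_n| (D_0 + ... + D_(n-1))] is at most a constant times [D_n]: distortion is bounded
    at scale [1 / D_n] at every "good" time, i.e. whenever [|y_n| >= s]. An orbit with only
    finitely many good times drifts to the right to infinity.

    Orbits that stay to the left of a vertical line form a porous, hence null, set: at a
    good time one can pull back a point lying far to the right at the same height.
    From a good time with [x_n] large, unless [|sin (2 y_n)| <= e^(-l/2)] with [l <= x_n]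
    ("failure"), the orbit either jumps far to the right, or jumps far to the left, falls
    next to [0] and shadows the orbit of [0] until the next good time, where [x] is even
    larger. By bounded distortion failures of this itinerary are rare in dyadic squares of
    size [1 / D_n], and their proportions sum to at most one half; a density argument
    then shows that almost every orbit eventually never fails. *)

(** * The complex exponential *)

Section ComplexExp.
Variable R : realType.
Implicit Types (x y t : R) (z w h : R[i]).
Local Notation nc := (@Normc.normc R).
Local Notation Re := complex.Re.
Local Notation Im := complex.Im.

Lemma sin_mvt t : exists2 c, `|c| <= `|t| & sin t = t * cos c.
Proof.
wlog t0 : t / 0 < t.
  move=> H; have [t0|t0|->] := ltgtP t 0; last first.
  - by exists 0; rewrite ?normr0// sin0 mul0r.
  - exact: H.
  - have [|c cle e] := H (- t); first by lra.
    by exists c; [rewrite -(normrN t)|rewrite -[sin t]opprK -sinN e mulNr opprK].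
have [c] := @MVT R sin cos 0 t t0 (fun x _ => is_derive_sin x)
  (continuous_subspaceT (@continuous_sin R)).
rewrite in_itv /= => /andP[c0 ct]; rewrite sin0 !subr0 => e.
exists c; first by rewrite !ger0_norm ?ltW.
by rewrite e mulrC.
Qed.

Lemma norm_sin_le t : `|sin t| <= `|t|.
Proof.
have [c _ ->] := sin_mvt t.
by rewrite normrM ler_piMr// cos_max.
Qed.

Lemma cos_ge_quad t : 1 - t ^+ 2 / 2 <= cos t.
Proof.
have -> : cos t = 1 - 2 * sin (t / 2) ^+ 2.
  have -> : cos t = cos ((t / 2) *+ 2) by congr cos; lra.
  rewrite cos_mulr2n; have := cos2Dsin2 (t / 2); lra.
have := norm_sin_le (t / 2); rewrite -(ler_sqr) ?nnegrE// !real_normK ?num_real//.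
by move=> H; nra.
Qed.

Lemma sin_sub_le t : `|t| <= 1 -> `|sin t - t| <= t ^+ 2 / 2.
Proof.
move=> t1; have [c cle ->] := sin_mvt t.
have c2 : c ^+ 2 <= t ^+ 2.
  by rewrite -(real_normK (num_real c)) -(real_normK (num_real t)) lerXn2r// nnegrE.
rewrite -{2}(mulr1 t) -mulrBr normrM distrC (ger0_norm (x := 1 - cos c)); last first.
  by rewrite subr_ge0 cos_le1.
have := cos_ge_quad c; have : 0 <= 1 - cos c by rewrite subr_ge0 cos_le1.
rewrite -(real_normK (num_real t)) in c2 *.
move: `|t| (normr_ge0 t) t1 c2 => v v0 v1 c2 ? ?.
have : 1 - cos c <= v ^+ 2 / 2 by lra.
by move=> ?; nra.
Qed.

Lemma norm_le_2sin t : `|t| <= 1 -> `|t| <= 2 * `|sin t|.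
Proof.
move=> t1; have [c cle ->] := sin_mvt t.
have c2 : c ^+ 2 <= 1.
  rewrite -(real_normK (num_real c)) -(expr1n _ 2) lerXn2r// ?nnegrE//.
  exact: le_trans cle t1.
rewrite normrM; have := cos_ge_quad c.
have := ler_norm (cos c).
by have := normr_ge0 t; nra.
Qed.

(** By the double angle formula sin t = 2 sin (t/2) cos (t/2), and the cosine decreases. This keeps
    |sin t| / |t| below a constant smaller than 1 away from 0, the contraction used in
    [sder_bound]. *)
Lemma norm_sin_le_cos s t : 0 < s -> s <= `|t| -> `|t| <= 2 ->
  `|sin t| <= cos (s / 2) * `|t|.
Proof.
move=> s0 st t2; wlog t0 : t st t2 / 0 <= t.
  move=> H; have [/H->//|t0] := leP 0 t.
  by rewrite -normrN -sinN -(normrN t) H ?normrN// oppr_ge0 ltW.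
rewrite (ger0_norm t0) in st t2 *.
have -> : sin t = sin (t / 2 *+ 2) by congr sin; lra.
rewrite sin_mulr2n -mulr_natl !normrM.
have cle : cos (t / 2) <= cos (s / 2).
  have := @ltr_cos R; move=> /(_ (s / 2) (t / 2)).
  have := @pi_ge2 R; rewrite !in_itv/= => pi2.
  have [->|ts] := eqVneq s t; first by [].
  by move=> H; apply: ltW; rewrite H ?inE; [lra|apply/andP; split; lra..].
have c0 : 0 <= cos (t / 2).
  by apply: cos_ge0_pihalf; have := @pihalf_ge1 R; move=> ?; apply/andP; split; lra.
rewrite (ger0_norm c0) normr_nat.
have := norm_sin_le (t / 2); rewrite (ger0_norm (x := t / 2)); last lra.
by have := normr_ge0 (sin (t / 2)); nra.
Qed.

(** The upper bound comes from e^(-x) >= 1 - x, that is, e^x (1 - x) <= 1. *)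
Lemma expR_quad x : `|x| <= 8^-1 -> `|expR x - 1 - x| <= 8 / 7 * x ^+ 2.
Proof.
rewrite ler_norml => /andP[x1 x2].
have e1 := expR_ge1Dx x; have := expR_ge1Dx (- x).
have e0 := expR_gt0 x; have e2 := expRxMexpNx_1 x.
rewrite ger0_norm; last lra.
move=> e3.
have e4 : expR x * (1 - x) <= expR x * expR (- x) by rewrite ler_pM2l.
by rewrite e2 in e4; nra.
Qed.

Lemma nc_ge0 z : 0 <= nc z.
Proof. by case: z => x y; exact: sqrtr_ge0. Qed.

Lemma nc_sqr z : nc z ^+ 2 = Re z ^+ 2 + Im z ^+ 2.
Proof. by case: z => x y; rewrite /= sqr_sqrtr// addr_ge0// sqr_ge0. Qed.

Lemma nc_leP z x : 0 <= x -> (nc z <= x) = (Re z ^+ 2 + Im z ^+ 2 <= x ^+ 2).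
Proof. by move=> x0; rewrite -nc_sqr ler_sqr// nnegrE ?nc_ge0. Qed.

Lemma nc_le_l1 z : nc z <= `|Re z| + `|Im z|.
Proof.
rewrite nc_leP ?addr_ge0// -(real_normK (num_real (Re z))).
rewrite -(real_normK (num_real (Im z))).
by have := normr_ge0 (Re z); have := normr_ge0 (Im z); nra.
Qed.

Lemma Re_le_nc z : `|Re z| <= nc z.
Proof.
by rewrite -(ler_sqr) ?nnegrE ?nc_ge0// nc_sqr real_normK ?num_real// lerDl sqr_ge0.
Qed.

Lemma Im_le_nc z : `|Im z| <= nc z.
Proof.
by rewrite -(ler_sqr) ?nnegrE ?nc_ge0// nc_sqr real_normK ?num_real// lerDr sqr_ge0.
Qed.

Lemma nc_triangle z w : nc (z + w) <= nc z + nc w.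
Proof. exact: le_normcD. Qed.

Lemma ncN z : nc (- z) = nc z.
Proof. exact: normcN. Qed.

Lemma nc_triangleB z w : nc z - nc w <= nc (z + w).
Proof.
have := nc_triangle (z + w) (- w); rewrite addrK ncN; lra.
Qed.

Lemma ReD z w : Re (z + w) = Re z + Re w.
Proof. by case: z; case: w. Qed.

Lemma ImD z w : Im (z + w) = Im z + Im w.
Proof. by case: z; case: w. Qed.

Lemma ReB z w : Re (z - w) = Re z - Re w.
Proof. by case: z; case: w. Qed.

Lemma ImB z w : Im (z - w) = Im z - Im w.
Proof. by case: z; case: w. Qed.

Lemma cexpE z : cexp z = Complex (expR (Re z) * cos (Im z)) (expR (Re z) * sin (Im z)).
Proof.
by case: z => x y; rewrite /cexp /=; simpc.
Qed.

Lemma cexpD z w : cexp (z + w) = cexp z * cexp w.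
Proof.
rewrite !cexpE; case: z => x y; case: w => x' y' /=; simpc.
rewrite expRD cosD sinD; congr Complex; ring.
Qed.

Lemma nc_cexp z : nc (cexp z) = expR (Re z).
Proof.
apply/eqP; rewrite -(eqrXn2 (n:=2)) ?nc_ge0 ?expR_ge0//.
rewrite nc_sqr cexpE /= !exprMn -mulrDr cos2Dsin2 mulr1//.
Qed.

Lemma cexp_quad h : nc h <= 8^-1 -> nc (cexp h - 1 - h) <= 2 * nc h ^+ 2.
Proof.
move=> h8; have x8 := le_trans (Re_le_nc h) h8; have y8 := le_trans (Im_le_nc h) h8.
apply: (le_trans (nc_le_l1 _)); rewrite nc_sqr !ReB !ImB cexpE /=.
move: h8 x8 y8; set x := Re h; set y := Im h => _ x8 y8.
have y1 : `|y| <= 1 by lra.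
have ex := expR_quad x8; have cy := cos_ge_quad y; have cy1 := cos_le1 y.
have sy := sin_sub_le y1; have e0 := expR_gt0 x.
have sy1 := norm_sin_le y.
have ex1 : expR x <= 8 / 7 by move: ex x8; rewrite !ler_norml => /andP[_ ?] /andP[? ?]; nra.
have H1 : `|expR x * cos y - 1 - x| <= 8 / 7 * x ^+ 2 + 4 / 7 * y ^+ 2.
  have -> : expR x * cos y - 1 - x = (expR x - 1 - x) + expR x * (cos y - 1) by ring.
  apply: le_trans (ler_normD _ _) _; apply: lerD => //.
  rewrite normrM (gtr0_norm e0) distrC ger0_norm; nra.
have H2 : `|expR x * sin y - 0 - y| <= 8 / 7 * (`|x| * `|y|) + y ^+ 2 / 2.
  have -> : expR x * sin y - 0 - y = (expR x - 1) * sin y + (sin y - y) by ring.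
  apply: le_trans (ler_normD _ _) _; apply: lerD => //.
  rewrite normrM.
  have : `|expR x - 1| <= 8 / 7 * `|x|.
    have -> : expR x - 1 = (expR x - 1 - x) + x by ring.
    apply: le_trans (ler_normD _ _) _.
    rewrite -(real_normK (num_real x)) in ex; have := normr_ge0 x; nra.
  have := normr_ge0 x; have := normr_ge0 (expR x - 1); have := normr_ge0 (sin y).
  by move=> *; nra.
(* The cross term |x| |y| is at most (x^2 + y^2) / 2. *)
have := sqr_ge0 (`|x| - `|y|).
rewrite sqrrB !real_normK ?num_real// => H3.
have := sqr_ge0 x; have := sqr_ge0 y.
lra.
Qed.

Lemma cexp_sub1_le h : nc h <= 8^-1 -> nc (cexp h - 1) <= nc h * (1 + 2 * nc h).
Proof.
move=> h8; have := cexp_quad h8.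
have := nc_triangle (cexp h - 1 - h) h; rewrite subrK; lra.
Qed.

Lemma cexp_sub1_ge h : nc h <= 8^-1 -> nc h * (1 - 2 * nc h) <= nc (cexp h - 1).
Proof.
move=> h8; have := cexp_quad h8.
have := nc_triangleB h (cexp h - 1 - h).
have -> : h + (cexp h - 1 - h) = cexp h - 1 by ring.
lra.
Qed.

Lemma nc1 : nc 1 = 1.
Proof. exact: Normc.normc1. Qed.

Lemma nc_cexp_le h : nc h <= 8^-1 -> nc (cexp h) <= 1 + 2 * nc h.
Proof.
move=> h8; have := cexp_sub1_le h8; have := nc_ge0 h.
have := nc_triangle (cexp h - 1) 1; rewrite subrK nc1; nra.
Qed.

Lemma nc_cexp_ge h : nc h <= 8^-1 -> 1 - 2 * nc h <= nc (cexp h).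
Proof.
move=> h8; have := cexp_sub1_le h8; have := nc_ge0 h.
have := nc_triangleB 1 (cexp h - 1); have -> : 1 + (cexp h - 1) = cexp h by ring.
rewrite nc1; nra.
Qed.

Lemma norm_atan_le x : `|atan x| <= `|x|.
Proof.
wlog x0 : x / 0 < x.
  move=> H; have [x0|x0|->] := ltgtP x 0; last by rewrite atan0 normr0.
  - by rewrite -normrN -atanN -(normrN x) H ?oppr_gt0.
  - exact: H.
have [c] := @MVT R atan (fun y => (1 + y ^+ 2)^-1) 0 x x0
  (fun y _ => is_derive1_atan y)
  (continuous_subspaceT (@continuous_atan R)).
move=> _; rewrite atan0 !subr0 => ->.
rewrite normrM ler_piMl// ger0_norm ?invr_ge0 ?addr_ge0 ?sqr_ge0//.
by rewrite invf_le1 ?ltr_wpDr ?sqr_ge0// lerDl sqr_ge0.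
Qed.

(** A local logarithm: 1 + t lies in the right half-plane, so its argument is the arctangent of its
    slope. The rough bound 1/8 on |h| is proved first; [cexp_sub1_ge] then sharpens it to |t| (1 + 4
    |t|). *)
Lemma clog (t : R[i]) : nc t <= 16^-1 ->
  exists h, [/\ cexp h = 1 + t, nc h <= nc t * (1 + 4 * nc t) & nc h <= 8^-1].
Proof.
move=> t16; have := le_trans (Re_le_nc t) t16; have := le_trans (Im_le_nc t) t16.
have := nc_triangle 1 t; have := nc_triangleB 1 t; rewrite nc1.
have := nc_sqr (1 + t); rewrite ReD ImD /= add0r.
move E : (Re t) => p; move F : (Im t) => q rE r1 r2 q16 p16.
set r := nc (1 + t) in rE r1 r2.
have X0 : 0 < 1 + p by move: p16; rewrite ler_norml => /andP[? ?]; lra.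
pose v := q / (1 + p); pose th := atan v.
have qE : q = v * (1 + p) by rewrite /v mulfVK// gt_eqF.
have r0 : 0 < r by lra.
have rcos : r * cos th = 1 + p.
  rewrite cos_atan; have -> : r = (1 + p) * Num.sqrt (1 + v ^+ 2).
    apply/eqP; rewrite -(eqrXn2 (n:=2)) ?mulr_ge0 ?sqrtr_ge0 ?(ltW r0) ?(ltW X0)//.
    rewrite exprMn sqr_sqrtr ?addr_ge0 ?sqr_ge0// rE qE.
    by apply/eqP; ring.
  by rewrite mulfK// gt_eqF// sqrtr_gt0 ltr_wpDr ?sqr_ge0.
have c0 : cos th != 0.
  by apply/eqP => c0; move: rcos; rewrite c0 mulr0 => H; rewrite -H ltxx in X0.
have rsin : r * sin th = q.
  have := atanK v; rewrite -/th /tan => /(congr1 (fun c => c * cos th)).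
  by rewrite mulfVK// => ->; rewrite qE -rcos; ring.
have th15 : `|th| <= 15^-1.
  apply: (le_trans (norm_atan_le _)).
  rewrite /v normrM normfV (gtr0_norm X0) ler_pdivrMr//.
  by move: p16; rewrite ler_norml => /andP[? ?]; lra.
have ln15 : `|ln r| <= 15^-1.
  rewrite ler_norml; apply/andP; split.
    have := @le_ln1Dx R (r^-1 - 1).
    rewrite (_ : 1 + (r^-1 - 1) = r^-1); last by ring.
    rewrite lnV ?posrE// => H.
    have r15 : r^-1 <= 16 / 15.
      by rewrite -[16/15]invrK lef_pV2 ?posrE//; lra.
    have r'0 : 0 < r^-1 by rewrite invr_gt0.
    have : - ln r <= r^-1 - 1 by apply: H; lra.
    by lra.
  have := @le_ln1Dx R (r - 1).
  rewrite (_ : 1 + (r - 1) = r); last by ring.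
  move=> H.
  have : ln r <= r - 1 by apply: H; lra.
  by lra.
pose h := Complex (ln r) th.
have hE : cexp h = 1 + t.
  rewrite cexpE /= lnK ?posrE// rcos rsin -E -F.
  by case: (t) => ? ?; simpc.
have h8 : nc h <= 8^-1.
  rewrite nc_leP// /= -(real_normK (num_real (ln r))) -(real_normK (num_real th)).
  by have := normr_ge0 (ln r); have := normr_ge0 th; nra.
exists h; split=> //.
have := cexp_sub1_ge h8; rewrite hE addrAC subrr add0r.
have := nc_ge0 h; have := nc_ge0 t; move: (nc h) (nc t) h8 t16 => a b *.
have ab : a <= 4 / 3 * b by nra.
have : a * (1 - 8 / 3 * b) <= b by nra.
by nra.
Qed.

End ComplexExp.

(** * Orbits and distortion *)

Section Orbit.
Variable R : realType.
Variable a : nat -> R.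
Hypothesis a_gt0 : forall n, 0 < a n.
Implicit Types (z h k : R[i]).
Local Notation nc := (@Normc.normc R).
Local Notation Re := complex.Re.
Local Notation Im := complex.Im.

Fixpoint orb n z : R[i] := if n is p.+1 then exp_map (a p) (orb p z) else z.

(* As [f' = f], [der n z] is the modulus of the derivative of the n-th iterate at [z]. *)
Fixpoint der n z : R := if n is p.+1 then der p z * nc (orb p.+1 z) else 1.

Fixpoint sder n z : R := if n is p.+1 then sder p z + der p z else 0.

Lemma orbS n z : orb n.+1 z = exp_map (a n) (orb n z).
Proof. by []. Qed.

Lemma Re_orbS n z :
  Re (orb n.+1 z) = a n * expR (Re (orb n z)) * cos (Im (orb n z)).
Proof. by rewrite orbS /exp_map cexpE; simpc; rewrite /= mulrA. Qed.

Lemma Im_orbS n z :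
  Im (orb n.+1 z) = a n * expR (Re (orb n z)) * sin (Im (orb n z)).
Proof. by rewrite orbS /exp_map cexpE; simpc; rewrite /= mulrA. Qed.

Lemma nc_real (x : R) : nc (real_complex R x) = `|x|.
Proof. by rewrite /Normc.normc /= expr0n addr0 sqrtr_sqr. Qed.

Lemma nc_orbS n z : nc (orb n.+1 z) = a n * expR (Re (orb n z)).
Proof. by rewrite orbS /exp_map Normc.normcM nc_real nc_cexp gtr0_norm. Qed.

Lemma nc_orbS_gt0 n z : 0 < nc (orb n.+1 z).
Proof. by rewrite nc_orbS mulr_gt0// expR_gt0. Qed.

Lemma der_gt0 n z : 0 < der n z.
Proof. by elim: n => //= n IH; rewrite mulr_gt0// nc_orbS_gt0. Qed.

Lemma sder_ge0 n z : 0 <= sder n z.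
Proof. by elim: n => //= n IH; rewrite addr_ge0// ltW// der_gt0. Qed.

Lemma le_sder n m z : (n <= m)%N -> sder n z <= sder m z.
Proof.
elim: m => [|m IH]; first by rewrite leqn0 => /eqP ->.
rewrite leq_eqVlt => /orP[/eqP->//|]; rewrite ltnS => /IH /le_trans; apply.
by rewrite /= lerDl ltW// der_gt0.
Qed.

Lemma der_le_sder n m z : (n < m)%N -> der n z <= sder m z.
Proof.
move=> /le_sder -/(_ z); apply: le_trans.
by rewrite /= lerDr sder_ge0.
Qed.

Lemma orbS_add n z w k : orb n w = orb n z + k ->
  orb n.+1 w = orb n.+1 z * cexp k.
Proof. by move=> /= ->; rewrite /exp_map cexpD mulrA. Qed.

(** The induction step of [distortion], reduced to real numbers: h is the size of the initial
    perturbation, s and d are [sder] and [der] at the base point, d' is [der] at the perturbed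
    point, k is the size of the perturbation at time n, e and e' are the moduli of e^k - 1 and e^k
    (k complex), and U = |u_(n+1)|. *)
Lemma distortion_step (h s d d' k e e' U : R) :
  0 < U -> 0 < d -> 0 < d' -> 0 <= h -> 0 <= s -> 0 <= k ->
  h * (s + d) <= 16^-1 -> k <= 2 * (h * d) ->
  k * (1 - 4 * (h * s)) <= h * d -> h * d * (1 - 4 * (h * s)) <= k ->
  d' * (1 - 4 * (h * s)) <= d -> d * (1 - 4 * (h * s)) <= d' ->
  e <= k * (1 + 2 * k) -> k * (1 - 2 * k) <= e ->
  e' <= 1 + 2 * k -> 1 - 2 * k <= e' ->
  [/\ U * e * (1 - 4 * (h * (s + d))) <= h * (d * U),
      h * (d * U) * (1 - 4 * (h * (s + d))) <= U * e,
      d' * (U * e') * (1 - 4 * (h * (s + d))) <= d * U &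
      d * U * (1 - 4 * (h * (s + d))) <= d' * (U * e')].
Proof.
move=> U0 d0 d'0 h0 s0 k0; rewrite mulrDr (mulrA h d U).
have hd0 : 0 <= h * d by rewrite mulr_ge0// ltW.
have hs0 : 0 <= h * s by rewrite mulr_ge0.
move: (h * d) (h * s) hd0 hs0 => hd hs hd0 hs0 H k2 H1 H2 H3 H4 K1 K2 K3 K4.
have p0 : 0 <= 1 - 4 * (hs + hd) by lra.
split.
- have -> : U * e * (1 - 4 * (hs + hd)) = (e * (1 - 4 * (hs + hd))) * U by ring.
  rewrite ler_pM2r//.
  apply: (@le_trans _ _ (k * (1 + 2 * k) * (1 - 4 * (hs + hd)))).
    by rewrite ler_wpM2r.
  apply: le_trans (_ : k * (1 - 4 * hs) <= _) => //.
  by rewrite -mulrA ler_wpM2l//; nra.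
- have -> : hd * U * (1 - 4 * (hs + hd)) = (hd * (1 - 4 * (hs + hd))) * U by ring.
  rewrite [leRHS]mulrC ler_pM2r//.
  apply: le_trans (_ : k * (1 - 2 * k) <= _) => //.
  apply: le_trans (_ : hd * (1 - 4 * hs) * (1 - 2 * k) <= _).
    by rewrite -mulrA ler_wpM2l//; nra.
  by rewrite ler_wpM2r//; lra.
- have -> : d' * (U * e') * (1 - 4 * (hs + hd)) =
    (d' * (e' * (1 - 4 * (hs + hd)))) * U by ring.
  rewrite ler_pM2r//.
  apply: le_trans (_ : d' * (1 - 4 * hs) <= _) => //.
  by rewrite ler_pM2l//; nra.
- have -> : d * U * (1 - 4 * (hs + hd)) = (d * (1 - 4 * (hs + hd))) * U by ring.
  have -> : d' * (U * e') = d' * e' * U by ring.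
  rewrite ler_pM2r//.
  apply: le_trans (_ : d * (1 - 4 * hs) * e' <= _); last by rewrite ler_wpM2r//; lra.
  by rewrite -mulrA ler_pM2l//; nra.
Qed.

(** Step n changes each ratio by a factor between 1 - 2 |h_n| and 1 + 2 |h_n|, where |h_n| <= 2 |h|
    D_n. The loss 4 |h| D_n is exactly the increment of 4 |h| (D_0 + ... + D_(n-1)). *)
Lemma distortion n z h : nc h * sder n z <= 16^-1 ->
  [/\ nc (orb n (z + h) - orb n z) * (1 - 4 * (nc h * sder n z)) <= nc h * der n z,
      nc h * der n z * (1 - 4 * (nc h * sder n z)) <= nc (orb n (z + h) - orb n z),
      der n (z + h) * (1 - 4 * (nc h * sder n z)) <= der n z &
      der n z * (1 - 4 * (nc h * sder n z)) <= der n (z + h)].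
Proof.
elim: n => [|n IH] H.
  by rewrite /= addrAC subrr add0r; split; rewrite mulr0 mulr0 subr0 ?mulr1.
have d0 := der_gt0 n z; have s0 := sder_ge0 n z; have h0 := nc_ge0 h.
have hd : 0 <= nc h * der n z by rewrite mulr_ge0// ltW.
have hs : 0 <= nc h * sder n z by rewrite mulr_ge0.
have sE : sder n.+1 z = sder n z + der n z by [].
have H' : nc h * sder n z + nc h * der n z <= 16^-1 by rewrite -mulrDr -sE.
have [|H1 H2 H3 H4] := IH; first by lra.
set k := orb n (z + h) - orb n z in H1 H2.
have kE : orb n (z + h) = orb n z + k by rewrite /k; ring.
have k2 : nc k <= 2 * (nc h * der n z) by have := nc_ge0 k; nra.
have k8 : nc k <= 8^-1 by lra.
have uE := orbS_add kE.
have E1 : nc (orb n.+1 (z + h) - orb n.+1 z) = nc (orb n.+1 z) * nc (cexp k - 1).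
  by rewrite -Normc.normcM uE; congr nc; ring.
have E2 : der n.+1 z = der n z * nc (orb n.+1 z) by [].
have E3 : der n.+1 (z + h) = der n (z + h) * (nc (orb n.+1 z) * nc (cexp k)).
  by rewrite -Normc.normcM -uE.
rewrite E1 E2 E3 sE; apply: distortion_step k2 H1 H2 H3 H4 _ _ _ _ => //.
- exact: nc_orbS_gt0.
- exact: der_gt0.
- exact: nc_ge0.
- exact: cexp_sub1_le.
- exact: cexp_sub1_ge.
- exact: nc_cexp_le.
- exact: nc_cexp_ge.
Qed.

Lemma distortion2 n z h : nc h * sder n z <= 16^-1 ->
  [/\ nc (orb n (z + h) - orb n z) <= 2 * (nc h * der n z),
      nc h * der n z <= 2 * nc (orb n (z + h) - orb n z),
      der n (z + h) <= 2 * der n z & der n z <= 2 * der n (z + h)].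
Proof.
move=> H; have [H1 H2 H3 H4] := distortion H.
have hs : 0 <= nc h * sder n z by rewrite mulr_ge0 ?nc_ge0 ?sder_ge0.
have d0 := der_gt0 n z; have d'0 := der_gt0 n (z + h).
have hd : 0 <= nc h * der n z by rewrite mulr_ge0 ?nc_ge0// ltW.
have := nc_ge0 (orb n (z + h) - orb n z).
by move=> ?; split; nra.
Qed.

(** An inverse branch of the n-th iterate, built one step at a time: reaching u_(n+1) + k amounts to
    reaching u_n + log (1 + k / u_(n+1)) one step earlier. The correction 4 |k| [sder n z] absorbs
    the second order terms of the successive logarithms. *)
Lemma backward n z k : nc k * sder n z * 16 <= der n z ->
  exists h, orb n (z + h) = orb n z + k /\
    nc h * (der n z - 4 * (nc k * sder n z)) <= nc k.
Proof.
elim: n k => [|n IH] k H; first by exists k; rewrite /= mulr0 mulr0 subr0 mulr1.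
have d0 := der_gt0 n z; have s0 := sder_ge0 n z.
pose u := orb n.+1 z; have u0 : 0 < nc u by exact: nc_orbS_gt0.
pose t := k / u.
have un0 : u != 0 by apply/eqP => u00; rewrite u00 Normc.normc0 ltxx in u0.
have kE : k = t * u by rewrite /t mulfVK.
have t0 := nc_ge0 t.
have H' : nc t * (sder n z + der n z) * 16 <= der n z.
  move: H; rewrite kE Normc.normcM -[der n.+1 z]/(der n z * nc u) -[sder n.+1 z]/(sder n z + der n z).
  have -> : nc t * nc u * (sder n z + der n z) * 16 =
    nc t * (sder n z + der n z) * 16 * nc u by ring.
  by rewrite ler_pM2r.
have t16 : nc t <= 16^-1.
  have ts0 : 0 <= nc t * sder n z by rewrite mulr_ge0.
  have : nc t * 16 * der n z <= 1 * der n z by lra.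
  by rewrite ler_pM2r//; lra.
have [k' [k'E k't k'8]] := clog t16.
have k'0 := nc_ge0 k'.
have M : nc k' * sder n z <= nc t * (1 + 4 * nc t) * sder n z by rewrite ler_wpM2r.
have ts : 0 <= nc t * sder n z by rewrite mulr_ge0.
have td : 0 <= nc t * der n z by rewrite mulr_ge0// ltW.
have [|h [hE hk]] := IH k'.
  by nra.
exists h; split.
  by rewrite (orbS_add hE) k'E mulrDr mulr1 -/u kE (mulrC t).
rewrite kE Normc.normcM -[der n.+1 z]/(der n z * nc u) -[sder n.+1 z]/(sder n z + der n z).
have -> : nc h * (der n z * nc u - 4 * (nc t * nc u * (sder n z + der n z))) =
  nc h * (der n z - 4 * (nc t * (sder n z + der n z))) * nc u by ring.
rewrite ler_pM2r// -(@ler_pM2r _ (1 + 4 * nc t)); last by lra.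
apply: le_trans k't; apply: le_trans hk.
rewrite -mulrA ler_wpM2l ?nc_ge0//.
by nra.
Qed.

Lemma backward2 n z k : nc k * sder n z * 16 <= der n z ->
  exists h, orb n (z + h) = orb n z + k /\ nc h * der n z <= 2 * nc k.
Proof.
move=> H; have [h [hE hk]] := backward H; exists h; split=> //.
have := nc_ge0 h; have := nc_ge0 k; have := der_gt0 n z; nra.
Qed.

Lemma Im_orbS_abs n z : `|Im (orb n.+1 z)| = nc (orb n.+1 z) * `|sin (Im (orb n z))|.
Proof.
by rewrite Im_orbS nc_orbS normrM gtr0_norm// mulr_gt0// expR_gt0.
Qed.

End Orbit.

(** Since A > 1/e, ln A + 1 is positive and A >= e^(-1 + 2g) for some g > 0. One of the two g pays
    for the factor cos y on the strip |y| <= 2s; the other makes the real part grow by at least g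
    per step there. *)
Lemma growth_constants (R : realType) (A : R) : (expR 1)^-1 < A ->
  exists s g : R, [/\ 0 < s, s <= 4^-1, 0 < g, g <= 1 &
    forall alpha x y : R, A <= alpha -> `|y| <= 2 * s ->
      expR (x - 1 + g) <= alpha * expR x * cos y].
Proof.
move=> A_gt; have e0 := expR_gt0 (1 : R).
have A0 : 0 < A by apply: lt_trans A_gt; rewrite invr_gt0.
have lA : -1 < ln A.
  by rewrite -(@expRK R (-1)) ltr_ln ?posrE ?expR_gt0// expRN.
pose g := Num.min 1 ((ln A + 1) / 2).
have g0 : 0 < g by rewrite lt_min ltr01 /=; lra.
have g1 : g <= 1 by rewrite ge_min lexx.
have gA : expR (-1 + 2 * g) <= A.
  rewrite -(lnK A0) ler_expR.
  by have : g <= (ln A + 1) / 2 by [rewrite ge_min lexx orbT]; lra.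
(* This s gives cos y >= 1 - s >= 1 / (1 + g) >= e^(-g). *)
exists (Num.min 4^-1 (g / (1 + g))), g.
have q0 : 0 < g / (1 + g) by rewrite divr_gt0//; lra.
set s := Num.min _ _.
have s0 : 0 < s by rewrite lt_min q0 andbT; lra.
have s4 : s <= 4^-1 by rewrite ge_min lexx.
have sg : s <= g / (1 + g) by rewrite ge_min lexx orbT.
split=> // alpha x y Aa ys.
have cy : expR (- g) <= cos y.
  apply: le_trans (cos_ge_quad y).
  have y2 : y ^+ 2 <= (2 * s) ^+ 2.
    by rewrite -(real_normK (num_real y)) lerXn2r ?nnegrE//; lra.
  apply: (@le_trans _ _ (1 - s)); last by nra.
  apply: (@le_trans _ _ (1 + g)^-1).
    by rewrite expRN lef_pV2 ?posrE ?expR_gt0 ?expR_ge1Dx//; lra.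
  have -> : (1 + g)^-1 = 1 - g / (1 + g) by field; lra.
  by lra.
have -> : x - 1 + g = (- 1 + 2 * g) + x + (- g) by ring.
rewrite 2!expRD; apply: ler_pM => //; rewrite ?mulr_ge0 ?expR_ge0//.
by apply: ler_wpM2r; rewrite ?expR_ge0//; apply: le_trans Aa.
Qed.

(** * Growth to the right near the real axis, and the bound on sums of derivatives *)

Section Expansion.
Variable R : realType.
Variables (a : nat -> R) (A s g : R).
Hypothesis a_gt0 : forall n, 0 < a n.
Hypothesis a_ge : forall n, A <= a n.
Hypotheses (s_gt0 : 0 < s) (s_le : s <= 4^-1) (g_gt0 : 0 < g) (g_le1 : g <= 1).
Hypothesis growth : forall alpha x y : R, A <= alpha -> `|y| <= 2 * s ->
  expR (x - 1 + g) <= alpha * expR x * cos y.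
Implicit Types (z h k : R[i]).
Local Notation nc := (@Normc.normc R).
Local Notation Re := complex.Re.
Local Notation Im := complex.Im.
Local Notation u := (orb a).

Lemma Re_orbS_expR n z : `|Im (u n z)| <= 2 * s ->
  expR (Re (u n z) - 1 + g) <= Re (u n.+1 z).
Proof. by move=> H; rewrite Re_orbS; apply: growth. Qed.

Lemma Re_orbS_gt0 n z : `|Im (u n z)| <= 2 * s -> 0 < Re (u n.+1 z).
Proof. by move=> /Re_orbS_expR; apply: lt_le_trans; rewrite expR_gt0. Qed.

Lemma Re_orbS_ge n z : `|Im (u n z)| <= 2 * s -> Re (u n z) + g <= Re (u n.+1 z).
Proof.
move=> /Re_orbS_expR; apply: le_trans.
by have := expR_ge1Dx (Re (u n z) - 1 + g); lra.
Qed.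

Lemma Re_orb_run n z j : (forall i, (i < j)%N -> `|Im (u (n + i)%N z)| <= 2 * s) ->
  Re (u n z) + g * j%:R <= Re (u (n + j)%N z).
Proof.
elim: j => [|j IH] H; first by rewrite mulr0 addr0 addn0.
rewrite addnS; apply: le_trans (Re_orbS_ge (H j (ltnSn j))).
rewrite -natr1 mulrDr mulr1 addrA lerD2r.
by apply: IH => i ij; apply: H; rewrite ltnS ltnW.
Qed.

(* While [|Im| < s] the sum of the [|Im|] is absorbed by the growth of this bounded
   potential: the first term gains as long as [Re < 4], the second one afterwards. *)
Let clamp (x : R) := Num.max (Num.min x 4) (-1) + 1.
Let phi z := 3 / g * clamp (Re z) + 2 * Num.min `|Im z| 1.

Let clamp_ge0 x : 0 <= clamp x.
Proof.
have : -1 <= Num.max (Num.min x 4) (-1) by rewrite le_max lexx orbT.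
by rewrite /clamp; lra.
Qed.

Let clamp_le5 x : clamp x <= 5.
Proof.
have : Num.max (Num.min x 4) (-1) <= 4 by rewrite ge_max ge_min lexx orbT /=; lra.
by rewrite /clamp; lra.
Qed.

Let clamp_le x y : x <= y -> clamp x <= clamp y.
Proof.
move=> xy; rewrite lerD2r ge_max le_max le_min !ge_min xy lexx orbT /=.
by rewrite le_max lexx orbT.
Qed.

Let phi_ge0 z : 0 <= phi z.
Proof.
by rewrite addr_ge0// mulr_ge0// ?divr_ge0 ?ltW ?le_min ?normr_ge0 ?ler01//; lra.
Qed.

Let phi_le z : phi z <= 15 / g + 2.
Proof.
rewrite lerD//; last by rewrite ger_pMr// ge_min lexx orbT.
by rewrite mulrAC ler_pM2r ?invr_gt0//; have := clamp_le5 (Re z); lra.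
Qed.

Let phi_step n z : `|Im (u n z)| < s ->
  phi (u n z) + `|Im (u n z)| <= phi (u n.+1 z).
Proof.
move=> ys; have s0 := s_gt0; have s4 := s_le; have g0 := g_gt0; have g1 := g_le1.
have ss : s <= 2 * s by lra.
have ys2 := ltW (lt_le_trans ys ss).
have x'x := Re_orbS_ge ys2; have x'e := Re_orbS_expR ys2.
have x'0 := Re_orbS_gt0 ys2; have y'E := Im_orbS_abs a_gt0 n z.
have xn := le_trans (ler_norm _) (Re_le_nc (u n.+1 z)).
have min1 : Num.min `|Im (u n z)| 1 = `|Im (u n z)| by apply/min_idPl; lra.
have y0 := normr_ge0 (Im (u n z)).
rewrite /phi min1; move: x'x x'e x'0 y'E xn.
set x := Re (u n z); set x' := Re (u n.+1 z); set y' := Im (u n.+1 z).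
move=> x'x x'e x'0 y'E xn.
have g3 : 3 / g * g = 3 by rewrite mulfVK// gt_eqF.
have g3' : 0 < 3 / g by rewrite divr_gt0.
(* If x <= 4 - g, the clamped real part gains g, so the first term of [phi] gains 3. Otherwise x' >=
   4, hence |y'| >= 4 |sin y| >= 2 |y|, and the second term grows from 2 |y| to at least 4 |y|. *)
have [x4|x4] := leP x (4 - g).
  have Hc : clamp x + g <= clamp x'.
    rewrite /clamp; have [x1|x1] := leP x (-1).
      have -> : Num.min x 4 = x by apply/min_idPl; lra.
      have -> : Num.max x (-1) = -1 by apply/max_idPr.
      have : 0 <= Num.max (Num.min x' 4) (-1) by rewrite le_max le_min ltW//=; lra.
      by lra.
    have -> : Num.min x 4 = x by apply/min_idPl; lra.
    have -> : Num.max x (-1) = x by apply/max_idPl/ltW.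
    have : x + g <= Num.max (Num.min x' 4) (-1) by rewrite le_max le_min x'x /=; lra.
    by lra.
  have : 3 / g * (clamp x + g) <= 3 / g * clamp x' by rewrite ler_pM2l.
  have : 0 <= Num.min `|y'| 1 by rewrite le_min normr_ge0 ler01.
  by rewrite mulrDr g3; lra.
have Hc : 3 / g * clamp x <= 3 / g * clamp x' by rewrite ler_pM2l// clamp_le//; lra.
have y1 : `|Im (u n z)| <= 1 by lra.
have := norm_le_2sin y1 => Hsin.
have x'4 : 4 <= x' by apply: le_trans x'e; have := expR_ge1Dx (x - 1 + g); lra.
have : 2 * `|Im (u n z)| <= Num.min `|y'| 1.
  rewrite le_min; apply/andP; split; last by lra.
  by rewrite y'E; have := normr_ge0 (sin (Im (u n z))); nra.
by lra.
Qed.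

(** The induction carries the bounded potential [phi] next to the constant C. After division by
    |u_(n+1)| it remains to bound |sin y_n| (D_0 + ... + D_n). If |y_n| < s, the extra |y_n| D_n is
    paid by the growth of [phi]; if |y_n| >= s, |sin y_n| <= q |y_n| with q < 1 contracts. *)
Lemma sder_bound : exists2 C : R, 0 < C & forall n z,
  `|Im (u n z)| * sder a n z <= C * der a n z.
Proof.
have s_0 := s_gt0; have s_4 := s_le; have g0 := g_gt0; have g1 := g_le1.
pose q := Num.max (cos (s / 2)) 2^-1.
have q1 : q < 1.
  rewrite gt_max; apply/andP; split; last lra.
  have i0 : (0 : R) \in `[0, pi] by rewrite in_itv/= lexx pi_ge0.
  have i1 : s / 2 \in `[0, pi].
    by rewrite in_itv/=; have := @pi_ge2 R => ?; apply/andP; split; lra.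
  by have := ltr_cos i0 i1; rewrite cos0 => ->; lra.
have q0 : 0 < q by rewrite lt_max invr_gt0 ltr0n orbT.
pose K : R := 15 / g + 2.
have K0 : 0 < K by rewrite addr_gt0// divr_gt0.
(* C solves C = q (C + K) + 1, the balance of the contracting case, where K bounds [phi]. *)
pose C := (1 + q * K) / (1 - q).
have C0 : 0 < C by rewrite divr_gt0//; nra.
have CE : C * (1 - q) = 1 + q * K by rewrite /C mulfVK// gt_eqF//; lra.
suff H n z : `|Im (u n z)| * sder a n z <= (C + phi (u n z)) * der a n z.
  exists (C + K); first by rewrite addr_gt0.
  move=> n z; apply: le_trans (H n z) _.
  by rewrite ler_pM2r ?der_gt0// lerD2l.
elim: n => [|n IH]; first by rewrite mulr0 mulr1 addr_ge0// ltW.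
rewrite Im_orbS_abs// -[der a n.+1 z]/(der a n z * nc (u n.+1 z)).
rewrite -[sder a n.+1 z]/(sder a n z + der a n z).
have u0 := nc_orbS_gt0 a_gt0 n z; have d0 := der_gt0 a_gt0 n z.
have s0 := sder_ge0 a_gt0 n z.
suff H : `|sin (Im (u n z))| * (sder a n z + der a n z) <=
    (C + phi (u n.+1 z)) * der a n z.
  by rewrite -mulrA [der a n z * _]mulrC [leRHS]mulrCA ler_pM2l.
have [ys|ys] := ltP `|Im (u n z)| s.
  have := phi_step ys; have := norm_sin_le (Im (u n z)).
  have := normr_ge0 (sin (Im (u n z))).
  move: (phi (u n z)) (phi (u n.+1 z)) `|sin _| `|Im _| IH => p p' v y *.
  apply: (@le_trans _ _ (y * (sder a n z + der a n z))); first by rewrite ler_wpM2r//; lra.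
  by nra.
have Hq : `|sin (Im (u n z))| <= q * `|Im (u n z)|.
  have [y2|y2] := leP `|Im (u n z)| 2.
    apply: le_trans (norm_sin_le_cos s_gt0 ys y2) _.
    by rewrite ler_wpM2r// le_max lexx.
  apply: le_trans (sin_max _) _.
  have : 2^-1 * `|Im (u n z)| <= q * `|Im (u n z)| by rewrite ler_wpM2r// le_max lexx orbT.
  by lra.
have H1 := sin_max (Im (u n z)).
have phiK := phi_le (u n z).
have phi'0 := phi_ge0 (u n.+1 z).
have v0 := normr_ge0 (sin (Im (u n z))).
rewrite -/K in phiK.
move: (phi (u n z)) (phi (u n.+1 z)) `|sin _| `|Im _| IH Hq H1 phiK phi'0 v0 => p p' v y IH Hq H1 pK p'0 v0.
have : v * sder a n z <= q * ((C + p) * der a n z).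
  apply: (@le_trans _ _ (q * y * sder a n z)); first by rewrite ler_wpM2r.
  by rewrite -mulrA ler_pM2l//.
have : v * der a n z <= 1 * der a n z by rewrite ler_pM2r.
have : q * (C + p) <= q * (C + K) by rewrite ler_pM2l// lerD2l.
by nra.
Qed.

End Expansion.

(** * Dyadic coverings of the plane *)

Section Dyadic.
Variable R : realType.
Local Notation plane := (measurableTypeR R * measurableTypeR R)%type.
Local Notation mu := (@lebesgue_measure R \x @lebesgue_measure R)%E.
Implicit Types (k : nat) (c : int * int) (X Y : set plane).

Definition mesh k : R := 2^-1 ^+ k.

Definition dyadic k (i : int) : R := i%:~R * mesh k.

Definition square k c : set plane :=
  `[dyadic k c.1, dyadic k (c.1 + 1)[ `*` `[dyadic k c.2, dyadic k (c.2 + 1)[.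

Definition dilate (K : R) k c : set plane :=
  `[dyadic k c.1 - K * mesh k, dyadic k (c.1 + 1) + K * mesh k] `*`
  `[dyadic k c.2 - K * mesh k, dyadic k (c.2 + 1) + K * mesh k].

Lemma mesh_gt0 k : 0 < mesh k.
Proof. by rewrite exprn_gt0// invr_gt0. Qed.

Lemma le_mesh k k' : (k' <= k)%N -> mesh k <= mesh k'.
Proof. by move=> kk'; rewrite ler_wiXn2l//; lra. Qed.

Lemma dyadicD1 k i : dyadic k (i + 1) = dyadic k i + mesh k.
Proof. by rewrite /dyadic intrD mulrDl mul1r. Qed.

Lemma le_dyadic k i j : (dyadic k i <= dyadic k j) = (i <= j).
Proof. by rewrite ler_pM2r ?mesh_gt0// ler_int. Qed.

Lemma lt_dyadic k i j : (dyadic k i < dyadic k j) = (i < j).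
Proof. by rewrite ltr_pM2r ?mesh_gt0// ltr_int. Qed.

Lemma dyadic_refine k m i : dyadic k i = dyadic (k + m) (i * 2 ^+ m).
Proof.
rewrite /dyadic /mesh intrM rmorphXn/= exprD mulrACA -exprMn.
by rewrite mulfV ?expr1n ?mulr1// pnatr_eq0.
Qed.

Lemma dyadic_nested k k' i i' (x : R) : (k' <= k)%N ->
  dyadic k i <= x < dyadic k (i + 1) -> dyadic k' i' <= x < dyadic k' (i' + 1) ->
  dyadic k' i' <= dyadic k i /\ dyadic k (i + 1) <= dyadic k' (i' + 1).
Proof.
move=> /subnKC <- /andP[x1 x2] /andP[].
rewrite (dyadic_refine _ (k - k')) (dyadic_refine _ (k - k') (i' + 1)) => y1 y2.
rewrite !le_dyadic; split.
  by have := le_lt_trans y1 x2; rewrite lt_dyadic ltzD1.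
by have := le_lt_trans x1 y2; rewrite lt_dyadic -lezD1.
Qed.

(** Containment is recorded through end points, so that it passes to dilates as well as to
    squares. *)
Definition finer k c k' c' : Prop :=
  [/\ (k' <= k)%N, dyadic k' c'.1 <= dyadic k c.1,
   dyadic k (c.1 + 1) <= dyadic k' (c'.1 + 1), dyadic k' c'.2 <= dyadic k c.2 &
   dyadic k (c.2 + 1) <= dyadic k' (c'.2 + 1)].

Lemma square_finer k c k' c' : (k' <= k)%N -> square k c `&` square k' c' !=set0 ->
  finer k c k' c'.
Proof.
move=> kk' [p] [[]] /=; rewrite !in_itv/= => p1 p2 [] /=; rewrite !in_itv/= => p3 p4.
have [? ?] := dyadic_nested kk' p1 p3.
by have [? ?] := dyadic_nested kk' p2 p4; split.
Qed.

Lemma finer_square k c k' c' : finer k c k' c' -> square k c `<=` square k' c'.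
Proof.
move=> [_ h1 h2 h3 h4] p [] /=; rewrite !in_itv/= => /andP[a1 a2] /andP[a3 a4].
by split; rewrite /= ?in_itv/= ?(le_trans h1 a1) ?(le_trans h3 a3)/=;
  [exact: lt_le_trans h2|exact: lt_le_trans h4].
Qed.

Lemma finer_dilate K k c k' c' : 0 <= K -> finer k c k' c' ->
  dilate K k c `<=` dilate K k' c'.
Proof.
move=> K0 [kk' h1 h2 h3 h4] p [] /=; rewrite !in_itv/= => /andP[a1 a2] /andP[a3 a4].
have := ler_wpM2l K0 (le_mesh kk') => H.
by split; rewrite /= ?in_itv/=; apply/andP; split; lra.
Qed.

Lemma square_eq k c c' : square k c `&` square k c' !=set0 -> c = c'.
Proof.
move=> /[dup] /(square_finer (leqnn k))[_ h1 _ h3 _]; rewrite setIC.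
move=> /(square_finer (leqnn k))[_ h1' _ h3' _].
rewrite !le_dyadic in h1 h3 h1' h3'.
by case: c c' h1 h3 h1' h3' => [i j] [i' j'] /= *; congr pair; apply/le_anti/andP.
Qed.

Lemma measurable_square k c : measurable (square k c).
Proof. by apply: measurableX; exact: measurable_itv. Qed.

Lemma measurable_dilate K k c : measurable (dilate K k c).
Proof. by apply: measurableX; exact: measurable_itv. Qed.

Lemma rectangle_measure (b1 b2 b3 b4 : bool) (x y x' y' : R) : x <= y -> x' <= y' ->
  mu ([set` Interval (BSide b1 x) (BSide b2 y)] `*`
      [set` Interval (BSide b3 x') (BSide b4 y')]) = ((y - x) * (y' - x'))%:E.
Proof.
move=> xy xy'; rewrite product_measure1E; [|exact: measurable_itv..].
have E (b b' : bool) (v w : R) : v <= w ->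
    (lebesgue_measure [set` Interval (BSide b v) (BSide b' w)] = (w - v)%:E)%E.
  move=> vw; rewrite lebesgue_measure_itv/= lte_fin.
  case: ltP => // wv; have -> : v = w by apply/le_anti/andP.
  by rewrite subrr.
by rewrite EFinM; congr (_ * _)%E; exact: E.
Qed.

Lemma square_measure k c : mu (square k c) = (mesh k ^+ 2)%:E.
Proof.
have m0 := mesh_gt0 k.
rewrite rectangle_measure ?dyadicD1; [|lra..].
by congr (_%:E); ring.
Qed.

Lemma dilate_measure K k c : 0 <= K ->
  mu (dilate K k c) = (((2 * K + 1) ^+ 2)%:E * (mesh k ^+ 2)%:E)%E.
Proof.
move=> K0; have m0 := mesh_gt0 k; have Km := mulr_ge0 K0 (ltW m0).
rewrite rectangle_measure ?dyadicD1; [|lra..].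
by rewrite -EFinM; congr (_%:E); ring.
Qed.

Lemma square_exists k (p : plane) : exists c, square k c p.
Proof.
have m0 := mesh_gt0 k.
have H (x : R) : exists i : int, dyadic k i <= x < dyadic k (i + 1).
  exists (Num.floor (x / mesh k)); rewrite /dyadic -ler_pdivlMr//.
  by rewrite -ltr_pdivrMr// floor_itv.
have [i Hi] := H p.1; have [j Hj] := H p.2.
by exists (i, j); split; rewrite /= ?in_itv.
Qed.

Lemma mesh_between (r : R) : 0 < r -> r <= 1 -> exists2 k, mesh k <= r & r <= 2 * mesh k.
Proof.
move=> r0 r1.
have [n Hn] : exists n, mesh n <= r.
  have : (fun n => mesh n) @ \oo --> 0 by apply: cvg_expr; rewrite ger0_norm; lra.
  move=> /cvgr_le /(_ _ r0)[n _ /(_ n (leqnn n))]; exists n => //.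
pose P n := mesh n <= r.
have exP : exists n, P n by exists n.
have [k Pk kmin] := ex_minnP exP; exists k => //.
case: k Pk kmin => [|k] Pk kmin; first by rewrite /mesh expr0; lra.
have : ~~ P k by apply/negP => /kmin; rewrite ltnn.
by rewrite /P /mesh -ltNge exprS => H; lra.
Qed.

(** Used with [F] the trace of X on a square, for density, and with [F] a dilated square, for
    porosity. Monotonicity of [F] allows only the coarsest selected squares to be kept; these are
    disjoint, so their traces on Y add up. *)
Lemma dyadic_cover (P : nat -> int * int -> Prop) (F : nat -> int * int -> set plane)
    X Y (K : R) : 0 <= K -> measurable X -> measurable Y ->
  (forall k c, measurable (F k c)) ->
  (forall k c k' c', finer k c k' c' -> F k c `<=` F k' c') ->
  (forall k c, P k c -> (mu (F k c) <= K%:E * mu (Y `&` square k c))%E) ->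
  (forall p, X p -> exists k c, P k c /\ F k c p) ->
  (mu X <= K%:E * mu Y)%E.
Proof.
move=> K0 mX mY mF monoF PF XF.
(* The coarsest selected squares are pairwise disjoint and carry all the others. *)
pose Q k c := P k c /\ forall k' c', (k' < k)%N -> finer k c k' c' -> ~ P k' c'.
have QF k c p : P k c -> F k c p -> exists k' c', Q k' c' /\ F k' c' p.
  elim/ltn_ind: k c => k IH c Pkc Fp.
  have [Qkc|nQ] := pselect (Q k c); first by exists k, c.
  have [k' [c' [k'k ff P']]] : exists k' c', [/\ (k' < k)%N, finer k c k' c' & P k' c'].
    apply: contrapT => H; apply: nQ; split=> // k' c' k'k ff P'.
    by apply: H; exists k', c'.
  by apply: (IH k' k'k c' P'); exact: monoF ff _ Fp.
(* With [pickle_inv] each square has exactly one index, as the disjointness of the [S n] requires;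
   other indices contribute the empty set. *)
pose idx n : option (nat * (int * int)) := pickle_inv n.
pose G n := if idx n is Some kc then if `[< Q kc.1 kc.2 >] then F kc.1 kc.2 else set0
  else set0.
pose S n := if idx n is Some kc then
  if `[< Q kc.1 kc.2 >] then Y `&` square kc.1 kc.2 else set0 else set0.
have mG n : measurable (G n).
  by rewrite /G; case: (idx n) => // kc; case: ifP.
have mS n : measurable (S n).
  rewrite /S; case: (idx n) => // kc; case: ifP => // _.
  by apply: measurableI => //; exact: measurable_square.
have XG : X `<=` \bigcup_n G n.
  move=> p /XF[k [c [Pkc Fp]]]; have [k' [c' [Q' F']]] := QF _ _ _ Pkc Fp.
  exists (pickle (k', c')) => //; rewrite /G /idx pickleK_inv /=.
  by case: asboolP.
have GS n : (mu (G n) <= K%:E * mu (S n))%E.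
  rewrite /G /S; case: (idx n) => [kc|]; last by rewrite measure0 mule0.
  by case: asboolP => [[/PF]//|_]; rewrite measure0 mule0.
have tS : trivIset setT S.
  move=> n n' _ _ [p []]; rewrite /S.
  case En : (idx n) => [kc|//]; case En' : (idx n') => [kc'|//].
  case: asboolP => // -[Pk Qk] [_ Sk]; case: asboolP => // -[Pk' Qk'] [_ Sk'].
  have kc12 : kc = kc'.
    case: kc kc' {En En'} Pk Qk Sk Pk' Qk' Sk' => k c [k' c'] /= Pk Qk Sk Pk' Qk' Sk'.
    have kk' : k = k'.
      have [H|H|//] := ltngtP k k'.
        by case: (Qk' k c) => //; apply: square_finer (ltnW H) _; exists p.
      by case: (Qk k' c') => //; apply: square_finer (ltnW H) _; exists p.
    rewrite -kk' in Sk' *; congr pair; apply: (@square_eq k).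
    by exists p.
  have pinv m kc0 : idx m = Some kc0 -> m = pickle kc0.
    by rewrite /idx => E; have := @pickle_invK (nat * (int * int))%type m; rewrite E.
  by rewrite (pinv _ _ En) (pinv _ _ En') kc12.
apply: (@le_trans _ _ (\sum_(n <oo) mu (G n))%E).
  exact: measure_sigma_subadditive.
apply: (@le_trans _ _ (\sum_(n <oo) (K%:E * mu (S n)))%E).
  by apply: lee_nneseries => // n _; exact: measure_ge0.
rewrite nneseriesZl; last by move=> n _; exact: measure_ge0.
apply: lee_wpmul2l; first by rewrite lee_fin.
rewrite -measure_semi_bigcup//; last exact: bigcup_measurable.
apply: le_measure; rewrite ?inE//; first exact: bigcup_measurable.
move=> p [n _]; rewrite /S; case: (idx n) => [kc|//].
by case: asboolP => // _ [].
Qed.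

Lemma sparse_measure_le X Y (e : R) : 0 <= e -> measurable X -> measurable Y ->
  (forall p, X p -> exists k c, [/\ square k c p, square k c `<=` Y &
     (mu (X `&` square k c) <= e%:E * mu (square k c))%E]) ->
  (mu X <= e%:E * mu Y)%E.
Proof.
move=> e0 mX mY H.
apply: (@dyadic_cover (fun k c => square k c `<=` Y /\
    (mu (X `&` square k c) <= e%:E * mu (square k c))%E)
  (fun k c => X `&` square k c)) => //.
- by move=> k c; apply: measurableI => //; exact: measurable_square.
- by move=> k c k' c' ff; apply: setIS; exact: finer_square.
- by move=> k c [sY le]; rewrite (setIidr sY).
- by move=> p Xp; have [k [c [? ? ?]]] := H p Xp; exists k, c.
Qed.

(** The factor is the ratio of the areas of a dilated square and of the square itself. *)
Lemma holes_measure_le X Y (K : R) : 0 <= K -> measurable X -> measurable Y ->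
  (forall p, X p -> exists k c, square k c `<=` Y /\ dilate K k c p) ->
  (mu X <= ((2 * K + 1) ^+ 2)%:E * mu Y)%E.
Proof.
move=> K0 mX mY H.
apply: (@dyadic_cover (fun k c => square k c `<=` Y) (dilate K)) => //.
- by rewrite exprn_ge0//; lra.
- by move=> k c; exact: measurable_dilate.
- by move=> k c k' c' ff; exact: finer_dilate.
- by move=> k c sY; rewrite (setIidr sY) square_measure dilate_measure.
Qed.

(** * Null sets from decreasing outer approximations *)

Section Shrinking.
Variable V : nat -> set plane.
Hypothesis mV : forall j, measurable (V j).
Hypothesis niV : forall i j, (i <= j)%N -> V j `<=` V i.
Hypothesis V0_fin : (mu (V 0%N) < +oo)%E.

Let C := \bigcap_j V j.

Let mC : measurable C.
Proof. exact: bigcapT_measurable. Qed.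

Let cvgV : (fun j => mu (V j)) @ \oo --> mu C.
Proof.
apply: nonincreasing_cvg_mu => // i j ij.
by apply/subsetPset; exact: niV.
Qed.

Let C_fin : mu C \is a fin_num.
Proof.
rewrite ge0_fin_numE//; apply: le_lt_trans V0_fin.
by apply: le_measure; rewrite ?inE// => p; exact.
Qed.

(** Summing over squares gives mu C <= mu (V j) / 2 for every j, hence mu C <= mu C / 2 in the
    limit, with mu C finite. The outer sets V j play the part of a density theorem. *)
Lemma sparse_null (N : set plane) : measurable N -> mu N = 0%E ->
  (forall p, C p -> ~ N p -> forall j, exists k c, [/\ square k c p,
     square k c `<=` V j & (mu (C `&` square k c) <= 2^-1%:E * mu (square k c))%E]) ->
  mu C = 0%E.
Proof.
move=> mN N0 H.
have le_C j : (mu C <= 2^-1%:E * mu (V j))%E.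
  have mD : measurable (C `\` N) by exact: measurableD.
  have -> : mu C = mu (C `\` N).
    rewrite (measureDI mu mC mN) [X in (_ + X)%E](@subset_measure0 _ _ _ _ (C `&` N) N) ?adde0//.
    exact: measurableI.
  apply: sparse_measure_le => // p [Cp Np].
  have [k [c [? ? le]]] := H p Cp Np j; exists k, c; split=> //.
  apply: le_trans le; apply: le_measure; rewrite ?inE.
  - by apply: measurableI => //; exact: measurable_square.
  - by apply: measurableI => //; exact: measurable_square.
  - by apply: setSI; exact: subDsetl.
have : (mu C <= 2^-1%:E * mu C)%E.
  have cv : (fun j => (2^-1%:E * mu (V j))%E) @ \oo --> (2^-1%:E * mu C)%E.
    by apply: cvgeZl cvgV.
  by apply: cvge_ge cv; exact: nearW le_C.
have : (0 <= mu C)%E by [].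
rewrite -(fineK C_fin) -EFinM !lee_fin => c0 c1.
by congr (_%:E); lra.
Qed.

(** The holes lie in V j minus C, so mu C is at most a constant times mu (V j) - mu C, which tends
    to 0. *)
Lemma porous_null (K : R) : 0 <= K ->
  (forall p, C p -> forall j, exists k c, square k c `<=` V j `\` C /\ dilate K k c p) ->
  mu C = 0%E.
Proof.
move=> K0 H; pose K' := (2 * K + 1) ^+ 2.
have le_C j : (mu C <= K'%:E * (mu (V j) - mu C))%E.
  have -> : (mu (V j) - mu C)%E = mu (V j `\` C).
    rewrite measureD//; last first.
      apply: le_lt_trans V0_fin; apply: le_measure; rewrite ?inE//.
      exact: niV.
    by rewrite setIidr// => p; exact.
  by apply: holes_measure_le => //; [exact: measurableD|move=> p Cp; exact: H].
have : (mu C <= K'%:E * (mu C - mu C))%E.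
  have cv : (fun j => (K'%:E * (mu (V j) - mu C))%E) @ \oo --> (K'%:E * (mu C - mu C))%E.
    apply: cvgeZl => //; apply: cvgeB cvgV (cvg_cst _).
    by apply: fin_num_adde_defr.
  by apply: cvge_ge cv; exact: nearW le_C.
rewrite subee// mule0 => le0.
by apply/le_anti; rewrite le0/=.
Qed.

End Shrinking.

End Dyadic.

(** * Good times *)

Section GoodTimes.
Variable R : realType.
Variables (a : nat -> R) (A B s g T : R).
Hypothesis a_gt0 : forall n, 0 < a n.
Hypothesis a_ge : forall n, A <= a n.
Hypothesis a_le : forall n, a n <= B.
Hypotheses (s_gt0 : 0 < s) (s_le : s <= 4^-1) (g_gt0 : 0 < g) (g_le1 : g <= 1).
Hypothesis growth : forall alpha x y : R, A <= alpha -> `|y| <= 2 * s ->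
  expR (x - 1 + g) <= alpha * expR x * cos y.
Hypothesis T_gt0 : 0 < T.
Hypothesis sderT : forall n z,
  `|complex.Im (orb a n z)| * sder a n z <= T * der a n z.
Implicit Types (z w h k : R[i]).
Local Notation nc := (@Normc.normc R).
Local Notation Re := complex.Re.
Local Notation Im := complex.Im.
Local Notation u := (orb a).

Lemma good_sder n z : s <= `|Im (u n z)| -> s * sder a n z <= T * der a n z.
Proof.
move=> sY; apply: le_trans (sderT n z).
by rewrite ler_wpM2r// sder_ge0.
Qed.

(** The distortion scale: at a good time s [sder] <= T [der], so r D_n <= 2 [kappa] implies r (D_0 +
    ... + D_(n-1)) <= 1/32. The bound 1/8 keeps the image of such a perturbation within 1/2 of
    u_n. *)
Definition kappa : R := Num.min 8^-1 (s / (64 * T)).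

Lemma kappa_gt0 : 0 < kappa.
Proof. by rewrite lt_min invr_gt0 ltr0n divr_gt0// mulr_gt0. Qed.

Lemma kappa_le : kappa <= 8^-1.
Proof. by rewrite ge_min lexx. Qed.

Lemma kappaE : 64 * T * kappa <= s.
Proof.
have T64 : 0 < 64 * T by rewrite mulr_gt0.
by rewrite mulrC -ler_pdivlMr// ge_min lexx orbT.
Qed.

Lemma good_small n z (r : R) : s <= `|Im (u n z)| -> 0 <= r ->
  r * der a n z <= 2 * kappa -> r * sder a n z <= 32^-1.
Proof.
move=> sY r0 rk; have H := good_sder sY; have kE := kappaE.
have s0 := s_gt0; have T0 := T_gt0.
rewrite -(@ler_pM2l _ s)//.
have : r * (s * sder a n z) <= r * (T * der a n z) by rewrite ler_wpM2l.
have : T * (r * der a n z) <= T * (2 * kappa) by rewrite ler_pM2l.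
lra.
Qed.

Lemma good_distortion n z w : s <= `|Im (u n z)| ->
  nc (w - z) * der a n z <= 2 * kappa ->
  [/\ nc (u n w - u n z) <= 2 * (nc (w - z) * der a n z),
      nc (w - z) * der a n z <= 2 * nc (u n w - u n z),
      der a n w <= 2 * der a n z & der a n z <= 2 * der a n w].
Proof.
move=> sY H; have := good_small sY (nc_ge0 _) H => H'.
have := @distortion2 _ _ a_gt0 n z (w - z).
rewrite [z + (w - z)]addrC subrK; apply; lra.
Qed.

Lemma orb_continuous n z (e : R) : 0 < e ->
  exists2 r : R, 0 < r & forall w, nc (w - z) <= r ->
    forall j, (j <= n)%N -> nc (u j w - u j z) <= e.
Proof.
move=> e0; have s1 := sder_ge0 a_gt0 n z.
have d1 := der_gt0 a_gt0 n z.
(* This one sum dominates both [der] and [sder] at all times up to n. *)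
pose S := sder a n.+1 z; have S0 : 0 < S by rewrite /S /=; lra.
pose m := Num.min 16^-1 (e / 2).
have m0 : 0 < m by rewrite lt_min invr_gt0 ltr0n divr_gt0.
exists (m / S); first by rewrite divr_gt0.
move=> w; rewrite ler_pdivlMr// => wS j jn.
have w0 := nc_ge0 (w - z).
have jS : der a j z <= S by apply: der_le_sder.
have jS' : sder a j z <= S by apply: le_sder => //; rewrite leqW.
have m1 : m <= 16^-1 by rewrite ge_min lexx.
have m2 : m <= e / 2 by rewrite ge_min lexx orbT.
have H1 : nc (w - z) * sder a j z <= 16^-1.
  by apply: le_trans m1; apply: le_trans wS; rewrite ler_wpM2l.
have [H2 _ _ _] := distortion2 a_gt0 H1.
rewrite [z + (w - z)]addrC subrK in H2.
have : nc (w - z) * der a j z <= nc (w - z) * S by rewrite ler_wpM2l.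
lra.
Qed.

(** With c = s / T, a good time has D_n >= c (D_0 + ... + D_(n-1)), and this sum is at least D_0 = 1
    when n > 0. Each good time thus adds at least c to the sum; with infinitely many of them the sum
    diverges, and so does D_n along good times. *)
Lemma good_der_large z (M : R) n1 :
  (forall n1, exists2 n, (n1 <= n)%N & s <= `|Im (u n z)|) ->
  exists n, [/\ (n1 <= n)%N, s <= `|Im (u n z)| & M <= der a n z].
Proof.
move=> good; have s0 := s_gt0; have T0 := T_gt0.
pose c := s / T; have c0 : 0 < c by rewrite divr_gt0.
have cder n : s <= `|Im (u n z)| -> c * sder a n z <= der a n z.
  by move=> /good_sder H; rewrite /c mulrAC ler_pdivrMr// [leRHS]mulrC.
have large m : exists N, c * m%:R <= sder a N z.
  elim: m => [|m [N HN]]; first by exists 0%N; rewrite mulr0.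
  have [n nN sY] := good N.+1; exists n.+1.
  have H1 := le_sder a_gt0 z (ltnW nN).
  have H2 : 1 <= sder a n z.
    by rewrite -[1]/(der a 0 z); apply: der_le_sder => //; apply: leq_ltn_trans nN.
  have H3 := cder n sY; have : c * 1 <= c * sder a n z by rewrite ler_pM2l.
  by rewrite -[sder a n.+1 z]/(sder a n z + der a n z) -natr1; lra.
pose m := (Num.truncn (M / c / c)).+1.
have [N HN] := large m; have [n nN sY] := good (maxn n1 N).
exists n; rewrite geq_max in nN; case/andP: nN => n1n Nn; split=> //.
have mM : M / c / c < m%:R by rewrite /m; exact: truncnS_gt.
rewrite !ltr_pdivrMr// in mM.
have := cder n sY; have := le_sder a_gt0 z Nn => H1 H2.
have : c * (c * m%:R) <= c * sder a n z by rewrite ler_pM2l//; apply: le_trans H1.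
lra.
Qed.

(** Without good times the real part would gain g at every step and pass L. *)
Lemma bounded_good z (L : R) N : (forall n, (N <= n)%N -> Re (u n z) <= L) ->
  forall n1, exists2 n, (n1 <= n)%N & s <= `|Im (u n z)|.
Proof.
move=> xL n1; apply: contrapT => H; have s0 := s_gt0; have g0 := g_gt0.
have small n : (maxn N n1 <= n)%N -> `|Im (u n z)| <= 2 * s.
  rewrite geq_max => /andP[_ n1n]; rewrite leNgt; apply/negP => sY.
  by apply: H; exists n => //; lra.
pose n0 := maxn N n1.
pose j := (Num.truncn ((L - Re (u n0 z)) / g)).+1.
have run i : (i < j)%N -> `|Im (u (n0 + i)%N z)| <= 2 * s.
  by move=> _; apply: small; rewrite leq_addr.
have := Re_orb_run a_ge growth run.
have := xL (n0 + j)%N (leq_trans (leq_maxl N n1) (leq_addr j n0)).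
have : (L - Re (u n0 z)) / g < j%:R by rewrite /j; exact: truncnS_gt.
rewrite ltr_pdivrMr//; lra.
Qed.

(** Pulling back a move by [kappa] to the right keeps the height at time n, so the new point is good
    as well and the move can be repeated m times. Each move changes the derivative by a factor of at
    most 2, whence the recursions for C and c. *)
Lemma shift_right (L : R) m : exists C c : R, [/\ 0 < C, 0 < c, c <= 1 & forall n z,
  s <= `|Im (u n z)| -> L + 1 - kappa * m%:R <= Re (u n z) ->
  exists z', nc (z' - z) * der a n z <= C /\
    forall w, nc (w - z') * der a n z <= c -> L < Re (u n w)].
Proof.
have k0 := kappa_gt0; have k8 := kappa_le.
elim: m => [|m [C [c [C0 c0 c1 IH]]]].
  exists 1, kappa; split=> //; first by lra.
  move=> n z sY; rewrite mulr0 subr0 => xL.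
  exists z; split; first by rewrite subrr Normc.normc0 mul0r.
  move=> w wk; have [|H _ _ _] := good_distortion (w := w) sY; first by lra.
  have := Re_le_nc (u n w - u n z); rewrite ReB ler_norml => /andP[? _]; lra.
exists (2 * C + 2), (c / 2); split; [lra|lra|lra|] => n z sY xL.
have kn : nc (real_complex R kappa) = kappa by rewrite nc_real gtr0_norm.
have [|h [hE hk]] := @backward2 _ _ a_gt0 n z (real_complex R kappa).
  have H := good_sder sY; have kE := kappaE; rewrite kn.
  have s0 := s_gt0; have T0 := T_gt0; have d0 := der_gt0 a_gt0 n z.
  rewrite -(@ler_pM2l _ s)//.
  have : kappa * (s * sder a n z) <= kappa * (T * der a n z) by rewrite ler_pM2l.
  have : 64 * T * kappa * der a n z <= s * der a n z by rewrite ler_pM2r.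
  have : 0 <= T * kappa * der a n z by rewrite !mulr_ge0 ?ltW.
  lra.
rewrite kn in hk.
have zh : z + h - z = h by ring.
have [|_ _ D1 D2] := good_distortion (w := z + h) sY; first by rewrite zh.
have [||z' [z'1 z'2]] := IH n (z + h).
- by rewrite hE ImD /= addr0.
- by rewrite hE ReD /=; rewrite -natr1 in xL; lra.
have d0 := der_gt0 a_gt0 n z.
exists z'; split.
  have := nc_triangle (z' - (z + h)) h.
  have -> : z' - (z + h) + h = z' - z by ring.
  have := nc_ge0 (z' - (z + h)) => v0 tri.
  have : nc (z' - (z + h)) * der a n z <= nc (z' - (z + h)) * (2 * der a n (z + h)).
    by rewrite ler_wpM2l.
  have : nc (z' - z) * der a n z <= (nc (z' - (z + h)) + nc h) * der a n z.
    by rewrite ler_pM2r.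
  lra.
move=> w wc; apply: z'2.
have : nc (w - z') * der a n (z + h) <= nc (w - z') * (2 * der a n z).
  by rewrite ler_wpM2l ?nc_ge0.
lra.
Qed.

Lemma escape_hole (L : R) : exists C c : R, [/\ 0 < C, 0 < c, c <= 1 &
  forall N z (M : R), (forall n, (N <= n)%N -> Re (u n z) <= L) ->
  exists n z', [/\ (N <= n)%N, M <= der a n z, nc (z' - z) * der a n z <= C &
    forall w, nc (w - z') * der a n z <= c -> L < Re (u n w)]].
Proof.
(* As long as x_n <= L, |u_(n+1)| <= B e^L bounds x_(n+1) from below, so a fixed number of moves
   suffices. The good time is taken after N + 1 so that it has a predecessor to which this
   applies. *)
pose m := (Num.truncn ((L + 1 + B * expR L) / kappa)).+1.
have [C [c [C0 c0 c1 H]]] := shift_right L m.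
exists C, c; split=> // N z M xL.
have [n [Nn sY dM]] := good_der_large M N.+1 (bounded_good xL).
have [|z' [H1 H2]] := H n z sY; last by exists n, z'; split=> //; exact: ltnW.
have mk : (L + 1 + B * expR L) / kappa < m%:R by rewrite /m; exact: truncnS_gt.
rewrite ltr_pdivrMr ?kappa_gt0// in mk.
case: n Nn sY dM => // n Nn _ _.
have un : nc (u n.+1 z) <= B * expR L.
  rewrite nc_orbS//; apply: ler_pM; rewrite ?expR_ge0//; first exact: ltW.
  by rewrite ler_expR; exact: xL.
have := Re_le_nc (u n.+1 z); rewrite ler_norml => /andP[? _].
lra.
Qed.

End GoodTimes.

(** * Almost every orbit is unbounded to the right *)

Section Plane.
Variable R : realType.
Local Notation plane := (measurableTypeR R * measurableTypeR R)%type.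
Local Notation mu := (@lebesgue_measure R \x @lebesgue_measure R)%E.
Local Notation nc := (@Normc.normc R).
Local Notation Re := complex.Re.
Local Notation Im := complex.Im.

Definition pt (p : plane) : R[i] := Complex p.1 p.2.

Definition box (M : nat) : set plane := `]- M%:R, M%:R[ `*` `]- M%:R, M%:R[.

Lemma measurable_box M : measurable (box M).
Proof. by apply: measurableX; exact: measurable_itv. Qed.

Lemma box_fin M : (mu (box M) < +oo)%E.
Proof. by rewrite rectangle_measure ?ltry//; have := ler0n R M; lra. Qed.

Lemma box_cover : \bigcup_M box M = setT.
Proof.
apply/seteqP; split=> // p _; pose M := (Num.truncn (`|p.1| + `|p.2|)).+1.
have H : `|p.1| + `|p.2| < M%:R by rewrite /M; exact: truncnS_gt.
exists M => //; have := normr_ge0 p.1; have := normr_ge0 p.2 => h1 h2.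
by split; rewrite /= in_itv/= -ltr_norml; lra.
Qed.

Lemma box_open M p : box M p ->
  exists2 r : R, 0 < r & forall q, nc (pt q - pt p) <= r -> box M q.
Proof.
move=> [/=]; rewrite !in_itv/= => /andP[h1 h2] /andP[h3 h4].
pose m := Num.min (Num.min (p.1 + M%:R) (M%:R - p.1)) (Num.min (p.2 + M%:R) (M%:R - p.2)).
have m0 : 0 < m by rewrite !lt_min; repeat (apply/andP; split); lra.
have [m1 m2 m3 m4] : [/\ m <= p.1 + M%:R, m <= M%:R - p.1, m <= p.2 + M%:R & m <= M%:R - p.2].
  by split; rewrite !ge_min lexx ?orbT.
exists (m / 2); first by rewrite divr_gt0.
move=> q qp; have := le_trans (Re_le_nc (pt q - pt p)) qp.
have := le_trans (Im_le_nc (pt q - pt p)) qp.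
rewrite ReB ImB !ler_norml /= => /andP[h5 h6] /andP[h7 h8].
by split; rewrite /= in_itv/=; apply/andP; split; lra.
Qed.

Lemma square_dist k c p q : square k c p -> square k c q ->
  nc (pt q - pt p) <= 2 * mesh R k.
Proof.
move=> [/=]; rewrite !in_itv/= !dyadicD1 => /andP[h1 h2] /andP[h3 h4].
move=> [/=]; rewrite !in_itv/= !dyadicD1 => /andP[h5 h6] /andP[h7 h8].
apply: (le_trans (nc_le_l1 (pt q - pt p))); rewrite ReB ImB /=.
have : `|q.1 - p.1| <= mesh R k by rewrite ler_norml; apply/andP; split; lra.
have : `|q.2 - p.2| <= mesh R k by rewrite ler_norml; apply/andP; split; lra.
lra.
Qed.

Lemma dilate_near (K : R) k c p q : square k c p -> nc (pt p - pt q) <= K * mesh R k ->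
  dilate K k c q.
Proof.
move=> [/=]; rewrite !in_itv/= => /andP[h1 h2] /andP[h3 h4] qp.
have := le_trans (Re_le_nc (pt p - pt q)) qp.
have := le_trans (Im_le_nc (pt p - pt q)) qp.
rewrite ReB ImB !ler_norml /= => /andP[h5 h6] /andP[h7 h8].
by split; rewrite /= in_itv/=; apply/andP; split; lra.
Qed.

Lemma measurable_level (f : plane -> R) (i : interval R) :
  measurable_fun [set: plane] f -> measurable [set p | f p \in i].
Proof.
move=> mf; rewrite -[X in measurable X]setTI.
by apply: (mf _ [set` i]) => //; exact: measurable_itv.
Qed.

Lemma measurable_orb (a : nat -> R) n :
  measurable_fun [set: plane] (fun p : plane => Re (orb a n (pt p)) : R) /\
  measurable_fun [set: plane] (fun p : plane => Im (orb a n (pt p)) : R).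
Proof.
elim: n => [|n [mRe mIm]]; first by split; [exact: measurable_fst|exact: measurable_snd].
have mE : measurable_fun [set: plane] (fun p : plane => a n * expR (Re (orb a n (pt p)))).
  by apply: measurable_funM => //; apply: measurableT_comp mRe; exact: measurable_expR.
split.
- under eq_fun do rewrite Re_orbS.
  apply: measurable_funM => //; apply: measurableT_comp mIm.
  by apply: continuous_measurable_fun; exact: continuous_cos.
- under eq_fun do rewrite Im_orbS.
  apply: measurable_funM => //; apply: measurableT_comp mIm.
  by apply: continuous_measurable_fun; exact: continuous_sin.
Qed.

End Plane.

Section Unbounded.
Variable R : realType.
Local Notation plane := (measurableTypeR R * measurableTypeR R)%type.
Local Notation mu := (@lebesgue_measure R \x @lebesgue_measure R)%E.
Local Notation nc := (@Normc.normc R).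
Local Notation Re := complex.Re.
Local Notation Im := complex.Im.
Variables (a : nat -> R) (A B s g T : R).
Hypothesis a_gt0 : forall n, 0 < a n.
Hypothesis a_ge : forall n, A <= a n.
Hypothesis a_le : forall n, a n <= B.
Hypotheses (s_gt0 : 0 < s) (s_le : s <= 4^-1) (g_gt0 : 0 < g) (g_le1 : g <= 1).
Hypothesis growth : forall alpha x y : R, A <= alpha -> `|y| <= 2 * s ->
  expR (x - 1 + g) <= alpha * expR x * cos y.
Hypothesis T_gt0 : 0 < T.
Hypothesis sderT : forall n z,
  `|complex.Im (orb a n z)| * sder a n z <= T * der a n z.
Local Notation x_ n p := (Re (orb a n (pt p))).

Definition bounded_from (L : R) (N : nat) : set plane :=
  [set p | forall n, (N <= n)%N -> x_ n p <= L].

Lemma measurable_bounded_from L N : measurable (bounded_from L N).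
Proof.
have -> : bounded_from L N =
    \bigcap_(n in [set n | (N <= n)%N]) [set p : plane | x_ n p \in `]-oo, L]].
  by apply/seteqP; split=> p H n Nn; have := H n Nn; rewrite /= in_itv.
by apply: bigcap_measurableType => n _; apply: measurable_level; case: (measurable_orb a n).
Qed.

Lemma bounded_null_box L N M : mu (box M `&` bounded_from L N) = 0%E.
Proof.
(* Finitely many strict inequalities: V j contains a neighbourhood of each point of the limit set,
   where holes can be placed. *)
pose V j : set plane := box M `&` \bigcap_(n in [set n | (N <= n <= N + j)%N])
  [set p | x_ n p \in `]-oo, L + j.+1%:R^-1[].
have mV j : measurable (V j).
  apply: measurableI; first exact: measurable_box.
  by apply: bigcap_measurableType => n _; apply: measurable_level; case: (measurable_orb a n).
have niV i j : (i <= j)%N -> V j `<=` V i.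
  move=> ij p [Bp Hp]; split=> // n /andP[Nn nN].
  have := Hp n; rewrite /= !in_itv/= => H.
  apply: lt_le_trans (H _) _; first by rewrite Nn /= (leq_trans nN)// leq_add2l.
  by rewrite lerD2l lef_pV2 ?posrE// ler_nat.
have VE : \bigcap_j V j = box M `&` bounded_from L N.
  apply/seteqP; split=> p.
    move=> H; split; first by have [] := H 0%N I.
    move=> n Nn; apply/ler_addgt0Pr => e e0.
    pose j := maxn n (Num.truncn e^-1).
    have [_ /(_ n)] := H j I; rewrite /= in_itv/= => H'.
    apply: (le_trans (ltW (H' _))); first by rewrite Nn (leq_trans (leq_maxl n (Num.truncn e^-1)))// leq_addl.
    rewrite lerD2l -[leRHS]invrK lef_pV2 ?posrE ?invr_gt0//.
    apply: (le_trans (ltW (truncnS_gt _))).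
    by rewrite ler_nat ltnS leq_maxr.
  move=> [Bp Hp] j _; split=> // n /andP[Nn _].
  by rewrite /= in_itv/=; apply: le_lt_trans (Hp n Nn) _; rewrite ltrDl invr_gt0.
have [C [c [C0 c0 c1 hole]]] := escape_hole a_gt0 a_ge a_le s_gt0 g_gt0
  growth T_gt0 sderT L.
(* The hole will have mesh at least c / (4 D_n) and lie within C / D_n of the point: the ratio is 4
   C / c. *)
rewrite -VE; apply: (@porous_null _ V mV niV _ (4 * C / c)).
- by apply: le_lt_trans (box_fin R M); apply: le_measure; rewrite ?inE;
    [exact: mV|exact: measurable_box|move=> ? []].
- by rewrite divr_ge0 ?mulr_ge0// ltW.
move=> p Vp j; have [Bp Hp] : box M p /\ bounded_from L N p by move: Vp; rewrite VE.
have [r1 r10 Hr1] := box_open Bp.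
have j0 : 0 < (j.+1%:R : R)^-1 / 2 by rewrite divr_gt0// invr_gt0.
have [r2 r20 Hr2] := orb_continuous a_gt0 (N + j) (pt p) j0.
pose r := Num.min r1 r2; have r0 : 0 < r by rewrite lt_min r10.
(* D_n >= (C + c) / r puts the whole hole within r of p, hence inside V j. *)
have [n [z' [Nn dM z'C z'c]]] := hole N (pt p) (Num.max 1 ((C + c) / r)) Hp.
rewrite ge_max in dM; case/andP: dM => d1 dr.
rewrite ler_pdivrMr// in dr.
have d0 := lt_le_trans ltr01 d1; set d := der a n (pt p) in d0 d1 dr z'C z'c.
(* A square of mesh at most [rho] has diameter at most c / D_n. *)
pose rho := c / (2 * d).
have rhoE : rho * d = c / 2 by rewrite /rho invfM mulrA mulfVK// gt_eqF.
have rho0 : 0 < rho by rewrite divr_gt0// mulr_gt0.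
have rho1 : rho <= 1 by rewrite ler_pdivrMr ?mulr_gt0//; lra.
have [k mk1 mk2] := mesh_between rho0 rho1.
pose p' : plane := (Re z', Im z').
have p'E : pt p' = z' by rewrite /p' /pt; case: (z').
have [cc sqp'] := square_exists k p'.
exists k, cc; split; last first.
  apply: dilate_near sqp' _; rewrite p'E.
  rewrite -(@ler_pM2r _ d)//; apply: (le_trans z'C).
  have -> : 4 * C / c * mesh R k * d = 4 * C / c * (mesh R k * d) by ring.
  have : rho * d <= 2 * mesh R k * d by rewrite ler_pM2r.
  rewrite rhoE => H; rewrite mulrAC ler_pdivlMr//; nra.
move=> q sq; have q1 := square_dist sqp' sq; rewrite p'E in q1.
have q2 : nc (pt q - z') * d <= c.
  have : nc (pt q - z') * d <= 2 * rho * d by rewrite ler_pM2r//; lra.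
  by rewrite -mulrA rhoE; lra.
have q3 : nc (pt q - pt p) <= r.
  rewrite -(@ler_pM2r _ d)//; have := nc_triangle (pt q - z') (z' - pt p).
  have -> : pt q - z' + (z' - pt p) = pt q - pt p by ring.
  move=> tri; have : nc (pt q - pt p) * d <= (nc (pt q - z') + nc (z' - pt p)) * d.
    by rewrite ler_pM2r.
  lra.
split; last first.
  move=> VV; have [_ /(_ n Nn)] : (box M `&` bounded_from L N) q by rewrite -VE.
  by rewrite leNgt => /negP; apply; exact: z'c.
split; first by apply: Hr1; apply: le_trans q3 _; rewrite ge_min lexx.
move=> i /andP[Ni iN].
have q4 : nc (pt q - pt p) <= r2 by apply: le_trans q3 _; rewrite ge_min lexx orbT.
have := le_trans (Re_le_nc _) (Hr2 _ q4 i iN).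
have := Hp i Ni; rewrite ReB ler_norml => H1 /andP[_ H2].
have H3 : x_ i q < L + j.+1%:R^-1.
  by move: j0 H2; move: (j.+1%:R^-1) => e j0 H2; lra.
by rewrite /= in_itv.
Qed.

Definition bounded_orbit : set plane :=
  \bigcup_L \bigcup_N bounded_from (L%:R) N.

Lemma measurable_bounded_orbit : measurable bounded_orbit.
Proof.
by do 2 (apply: bigcupT_measurable => ?); exact: measurable_bounded_from.
Qed.

Lemma bounded_orbit_null : mu bounded_orbit = 0%E.
Proof.
apply: measure_negligible; first exact: measurable_bounded_orbit.
apply: negligible_bigcup => L; apply: negligible_bigcup => N.
rewrite -[bounded_from _ _]setTI -box_cover setI_bigcupl.
apply: negligible_bigcup => M; apply/negligibleP; last exact: bounded_null_box.
by apply: measurableI; [exact: measurable_box|exact: measurable_bounded_from].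
Qed.

End Unbounded.

(** * Itineraries of far away points *)

(** Bookkeeping of times for [itinerary_near]: if t is late, so is the good time n from which the
    current stage started. *)
Lemma itinerary_index n0 N J t : (n0 + N + J + 2 <= t)%N ->
  [/\ (n0 <= t)%N, (n0 + N <= t)%N, forall n, t = n.+1 -> (n0 + N <= n)%N &
   forall n j, t = (n.+2 + j)%N -> (j < J)%N -> (n0 + N <= n)%N].
Proof. by move=> H; split; [lia|lia|move=> n; lia|move=> n j; lia]. Qed.

Section Chain.
Variable R : realType.
Variables (a : nat -> R) (A B s g : R).
Hypothesis A_gt0 : 0 < A.
Hypothesis a_gt0 : forall n, 0 < a n.
Hypothesis a_ge : forall n, A <= a n.
Hypothesis a_le : forall n, a n <= B.
Hypotheses (s_gt0 : 0 < s) (s_le : s <= 4^-1) (g_gt0 : 0 < g) (g_le1 : g <= 1).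
Hypothesis growth : forall alpha x y : R, A <= alpha -> `|y| <= 2 * s ->
  expR (x - 1 + g) <= alpha * expR x * cos y.
Implicit Types (z w h k : R[i]).
Local Notation nc := (@Normc.normc R).
Local Notation Re := complex.Re.
Local Notation Im := complex.Im.
Local Notation u := (orb a).

Definition shift m : nat -> R := fun i => a (m + i)%N.

(** [orb (shift (n - k)) k 0] is the orbit of 0 started at time n - k. Closeness to infinity is
    measured by the real part, which does not depend on the lift of a point of the cylinder and
    bounds its norm from below. *)
Definition near_postsingular (e : R) n z : Prop :=
  e^-1 <= `|Re (u n z)| \/
  exists2 k, (k <= n)%N & nc (u n z - orb (shift (n - k)) k 0) <= e.

Lemma B_gt0 : 0 < B.
Proof. exact: lt_le_trans (a_gt0 0) (a_le 0). Qed.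

Let beta := g / (2 + 2 * B).

Let beta_gt0 : 0 < beta.
Proof. by have := B_gt0 => ?; rewrite divr_gt0//; lra. Qed.

(** Along a run, the gain in real part dominates beta times the logarithm of 2 |u_(n+1)|; the
    summand 2 B covers the factor 2 together with the coefficient, since 2 B <= e^(2B). *)
Let growth_lin x : x + beta * (x + 2 * B) <= expR (x - 1 + g).
Proof.
have B0 := B_gt0; have b0 := beta_gt0; have g0 := g_gt0; have g1 := g_le1.
have bE : beta * (2 + 2 * B) = g by rewrite /beta mulfVK// gt_eqF//; lra.
have -> : x - 1 + g = beta + (x - 1 + g - beta) by ring.
rewrite expRD; have := expR_ge1Dx beta; have := expR_ge1Dx (x - 1 + g - beta).
have := expR_gt0 beta; have := expR_gt0 (x - 1 + g - beta).
move: beta b0 bE (expR beta) (expR _) => b b0 bE e e' e'0 e0 H1 H2.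
have [x0|x0] := leP 0 (x + g - b).
  have : (1 + b) * (x + g - b) <= e * e' by apply: ler_pM; lra.
  nra.
have : 0 < e * e' by rewrite mulr_gt0.
nra.
Qed.

Definition run m j z := forall i, (i < j)%N -> `|Im (u (m + i)%N z)| < s.

Lemma runS m j z : run m j z -> `|Im (u (m + j)%N z)| < s -> run m j.+1 z.
Proof.
move=> H H' i; rewrite ltnS leq_eqVlt => /orP[/eqP->//|]; exact: H.
Qed.

Lemma runW m j z : run m j.+1 z -> run m j z.
Proof. by move=> H i ij; apply: H; apply: leq_trans ij _. Qed.

Let run_le m i z : `|Im (u (m + i)%N z)| < s -> `|Im (u (m + i)%N z)| <= 2 * s.
Proof. by have s0 := s_gt0; move=> ?; lra. Qed.

Lemma run_Re m j z : run m j z -> Re (u m z) + g * j%:R <= Re (u (m + j)%N z).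
Proof.
move=> H; apply: (Re_orb_run a_ge growth) => i ij.
by apply: run_le; exact: H.
Qed.

(** Derivatives along a run are controlled by the displacement alone, whatever its length. The spare
    factor 2^j pays for the loss of a factor 2 per step in [run_shadow]. *)
Lemma run_der m j z : run m j z -> 2 ^+ j * der a (m + j)%N z <=
  der a m z * expR ((Re (u (m + j)%N z) - Re (u m z)) / beta).
Proof.
elim: j => [|j IH] H.
  by rewrite addn0 expr0 mul1r subrr mul0r expR0 mulr1.
have := IH (runW H); have x'E := Re_orbS_expR a_ge growth (run_le (H j (ltnSn j))).
have := growth_lin (Re (u (m + j)%N z)).
rewrite addnS -[der a (m + j).+1 z]/(der a (m + j) z * nc (u (m + j).+1 z)).
move=> H1 H2; have b0 := beta_gt0; have B0 := B_gt0.
have H3 : 2 * nc (u (m + j).+1 z) <=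
    expR ((Re (u (m + j).+1 z) - Re (u (m + j)%N z)) / beta).
  apply: (@le_trans _ _ (expR (2 * B) * expR (Re (u (m + j)%N z)))).
    rewrite nc_orbS// mulrA ler_wpM2r ?expR_ge0//.
    have := expR_ge1Dx (2 * B); have := a_le (m + j); lra.
  rewrite -expRD ler_expR ler_pdivlMr//; lra.
have -> : (Re (u (m + j).+1 z) - Re (u m z)) / beta =
  (Re (u (m + j)%N z) - Re (u m z)) / beta +
  (Re (u (m + j).+1 z) - Re (u (m + j)%N z)) / beta by rewrite -mulrDl; congr (_ / _); ring.
rewrite expRD exprS [leRHS]mulrA [leLHS](_ : _ =
  (2 ^+ j * der a (m + j) z) * (2 * nc (u (m + j).+1 z))); last by ring.
apply: ler_pM H2 H3.
- by rewrite mulr_ge0 ?exprn_ge0// ltW// der_gt0.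
- by rewrite mulr_ge0// nc_ge0.
Qed.

Lemma run_Im m j z : `|Im (u (m + j)%N z)| * der a m z <=
  `|Im (u m z)| * der a (m + j)%N z.
Proof.
elim: j => [|j IH]; first by rewrite addn0.
rewrite addnS Im_orbS_abs// -[der a (m + j).+1 z]/(der a (m + j) z * nc (u (m + j).+1 z)).
have := norm_sin_le (Im (u (m + j)%N z)).
have n0 := nc_ge0 (u (m + j).+1 z); have d0 := der_gt0 a_gt0 m z => Hs.
rewrite -[leLHS]mulrA [leRHS](_ : _ = nc (u (m + j).+1 z) *
  (`|Im (u m z)| * der a (m + j) z)); last by ring.
apply: ler_wpM2l => //; apply: le_trans IH.
by rewrite ler_wpM2r// ltW.
Qed.

Lemma run_Im_exp m j z : run m j z ->
  `|Im (u (m + j)%N z)| <=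
  nc (u m z) * expR ((Re (u (m + j)%N z) - Re (u m z)) / beta).
Proof.
move=> H; have d0 := der_gt0 a_gt0 m z; rewrite -(ler_pM2r d0).
apply: (le_trans (run_Im m j z)); rewrite -mulrA [_ * der a m z]mulrC.
apply: ler_pM => //; [exact: ltW (der_gt0 a_gt0 _ _)|exact: Im_le_nc|].
apply: le_trans (run_der H); rewrite ler_peMl ?(ltW (der_gt0 _ _ _))//.
by rewrite exprn_ege1//; lra.
Qed.

(** The distance to the orbit of 0 is |u_m| at time m. One step multiplies it by at most 2
    |u_(n+1)|, because |e^(-h) - 1| <= 2 |h|. The smallness assumption keeps h below 1/8, and it
    passes to earlier times because the real part increases along the run. *)
Lemma run_shadow m j z : run m j z ->
  nc (u m z) * expR ((Re (u (m + j)%N z) - Re (u m z)) / beta) <= 8^-1 ->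
  nc (u (m + j)%N z - orb (shift m) j 0) * der a m z <=
  2 ^+ j * der a (m + j)%N z * nc (u m z).
Proof.
have d0 := der_gt0 a_gt0 m z.
elim: j => [|j IH] H small; first by rewrite addn0 subr0 expr0 mul1r mulrC.
have x'x := Re_orbS_ge a_ge growth (run_le (H j (ltnSn j))).
have b0 := beta_gt0; have g0 := g_gt0.
have small' : nc (u m z) * expR ((Re (u (m + j)%N z) - Re (u m z)) / beta) <= 8^-1.
  apply: le_trans small; rewrite ler_wpM2l ?nc_ge0// ler_expR ler_pM2r ?invr_gt0//.
  by rewrite addnS; lra.
have := IH (runW H) small'; set w := orb _ j 0; set h := u (m + j)%N z - w => hle.
have h8 : nc h <= 8^-1.
  rewrite -(ler_pM2r d0); apply: (le_trans hle).
  apply: (@le_trans _ _ (der a m z * expR ((Re (u (m + j)%N z) - Re (u m z)) / beta) * nc (u m z))).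
    by apply: ler_wpM2r; [exact: nc_ge0|exact: run_der (runW H)].
  by rewrite [leRHS]mulrC -mulrA [expR _ * _]mulrC ler_pM2l.
have wE : orb (shift m) j.+1 0 = u (m + j).+1 z * cexp (- h).
  have -> : orb (shift m) j.+1 0 = exp_map (a (m + j)) w by [].
  by rewrite orbS /exp_map -mulrA -cexpD; congr (_ * cexp _); rewrite /h; ring.
rewrite addnS wE.
have -> : u (m + j).+1 z - u (m + j).+1 z * cexp (- h) =
  - (u (m + j).+1 z * (cexp (- h) - 1)) by ring.
rewrite ncN Normc.normcM -[der a (m + j).+1 z]/(der a (m + j) z * nc (u (m + j).+1 z)).
have Nh8 : nc (- h) <= 8^-1 by rewrite ncN.
have := cexp_sub1_le Nh8; rewrite ncN => e1.
have e2 : nc (cexp (- h) - 1) <= 2 * nc h by have := nc_ge0 h; nra.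
have n0 := nc_ge0 (u (m + j).+1 z).
rewrite exprS -[leLHS]mulrA [leRHS](_ : _ =
  nc (u (m + j).+1 z) * (2 * (2 ^+ j * der a (m + j) z * nc (u m z)))); last by ring.
apply: ler_wpM2l => //.
have : nc (cexp (- h) - 1) * der a m z <= 2 * nc h * der a m z by rewrite ler_pM2r.
by lra.
Qed.

Lemma run_shadow_exp m j z : run m j z ->
  nc (u m z) * expR ((Re (u (m + j)%N z) - Re (u m z)) / beta) <= 8^-1 ->
  nc (u (m + j)%N z - orb (shift m) j 0) <=
  nc (u m z) * expR ((Re (u (m + j)%N z) - Re (u m z)) / beta).
Proof.
move=> H small; have d0 := der_gt0 a_gt0 m z; rewrite -(ler_pM2r d0).
apply: (le_trans (run_shadow H small)).
rewrite -mulrA [leRHS]mulrC [_ * nc _]mulrC mulrCA mulrA.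
rewrite [leLHS](_ : _ = nc (u m z) * (2 ^+ j * der a (m + j) z)); last by ring.
rewrite [leRHS](_ : _ = nc (u m z) * (der a m z *
  expR ((Re (u (m + j)%N z) - Re (u m z)) / beta))); last by ring.
by apply: ler_wpM2l; [exact: nc_ge0|exact: run_der].
Qed.

Definition jump (x : R) : R := A / 2 * expR (x / 2).

(** This linear lower bound is what [exit_good] needs: it turns x' + 1 >= beta (jump x - B / s) into
    x' + 1 >= 2 (x + 2). It holds because e^(x/2) >= x^2 / 8. *)
Lemma jump_large : exists2 L : R, 0 <= L &
  forall x, L <= x -> 2 / beta * (x + 2) + B / s <= jump x.
Proof.
have B0 := B_gt0; have b0 := beta_gt0; have s0 := s_gt0; have A0 := A_gt0.
pose p := 2 / beta; pose q := 2 * p + B / s.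
have p0 : 0 < p by rewrite divr_gt0//.
have Bs0 : 0 < B / s by rewrite divr_gt0.
have q0 : 0 < q by rewrite /q; lra.
exists (1 + 16 * (p + q) / A).
  by rewrite addr_ge0// divr_ge0 ?(ltW A0)//; lra.
move=> x xL.
have x1 : 1 <= x.
  by apply: le_trans xL; rewrite lerDl divr_ge0 ?(ltW A0)//; lra.
have xA : 16 * (p + q) <= A * x.
  by rewrite [leRHS]mulrC -ler_pdivrMr//; apply: le_trans xL; rewrite lerDr.
have e2 : x ^+ 2 / 8 <= expR (x / 2).
  have := @expR_ge1Dxn _ (x / 2) 1; rewrite (_ : 2`!%:R = 2)//.
  move=> H; have : 1 + (x / 2) ^+ 2 / 2 <= expR (x / 2) by apply: H; lra.
  by rewrite expr2; lra.
rewrite /jump (_ : _ + _ = p * x + q); last by rewrite /q /p; ring.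
have : q * 1 <= q * x by rewrite ler_pM2l.
move: p q (expR _) {q0 p0 xL} xA e2 => p q e xA e2 qx.
have : A / 2 * (x ^+ 2 / 8) <= A / 2 * e by rewrite ler_pM2l ?divr_gt0.
have : 16 * (p + q) * x <= A * x * x by rewrite ler_pM2r//; lra.
by rewrite expr2; lra.
Qed.

(** If |sin (2y)| > e^(-x/2), both |sin y| and |cos y| are at least e^(-x/2) / 2, while |u_(n+1)| >=
    A e^x. *)
Lemma jump_step n z : expR (- (Re (u n z) / 2)) < `|sin (Im (u n z) *+ 2)| ->
  jump (Re (u n z)) <= `|Re (u n.+1 z)| /\ jump (Re (u n z)) <= `|Im (u n.+1 z)|.
Proof.
set x := Re _; set y := Im _; rewrite sin_mulr2n -(mulr_natl (cos y * sin y)) !normrM normr_nat => H.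
have c1 := cos_max y; have s1 := sin_max y.
have c0 := normr_ge0 (cos y); have s0 := normr_ge0 (sin y).
have E : expR x = expR (x / 2) * expR (x / 2) by rewrite -expRD; congr expR; lra.
have e1 : expR (x / 2) * expR (- (x / 2)) = 1 by exact: expRxMexpNx_1.
have e0 := expR_gt0 (x / 2); have an := a_ge n; have A0 := A_gt0.
have aux v : expR (- (x / 2)) <= 2 * v ->
    jump x <= a n * (expR (x / 2) * expR (x / 2)) * v.
  move=> Hv; rewrite /jump.
  have : expR (x / 2) * expR (- (x / 2)) <= expR (x / 2) * (2 * v) by rewrite ler_pM2l.
  rewrite e1; set e := expR (x / 2) in e0 *; move=> H1.
  have : A * e * 1 <= a n * e * (e * (2 * v)).
    by apply: ler_pM => //; [rewrite mulr_ge0 ?ltW|rewrite ler_pM2r].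
  lra.
rewrite Re_orbS Im_orbS -/x -/y !normrM (gtr0_norm (expR_gt0 x)).
rewrite (gtr0_norm (a_gt0 n)) E; split; apply: aux; nra.
Qed.

Section Itinerary.
Variables (L : R) (n0 : nat) (z : R[i]).

(** The rate g / 2 is below the gain g per step of a run, so that the orbit can keep above the
    level, and it makes the failure widths e^(-level / 2) decay geometrically. *)
Definition level n : R := L + g / 2 * (n - n0)%:R.

Definition good n := s <= `|Im (u n z)| /\ level n <= Re (u n z).

Hypothesis L_ge0 : 0 <= L.
Hypothesis jumpL : forall x, L <= x -> 2 / beta * (x + 2) + B / s <= jump x.
Hypothesis start : good n0.
Hypothesis no_failure : forall n, (n0 <= n)%N -> good n ->
  expR (- (level n / 2)) < `|sin (Im (u n z) *+ 2)|.

(** After a jump to the left, |u_(n+2)| <= B e^(x_(n+1)) with x_(n+1) <= - jump (x_n). *)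
Definition plunged n := nc (u n.+2 z) <= B * expR (- jump (Re (u n z))).

(* The three cases: a good time; the time after a jump to the left; the orbit shadows
   the orbit of [0] since time [n.+2]. *)
Definition state t := [\/ good t,
  exists n, [/\ t = n.+1, (n0 <= n)%N, good n & Re (u t z) <= - jump (Re (u n z))] |
  exists n j, [/\ t = (n.+2 + j)%N, (n0 <= n)%N, good n, plunged n & run n.+2 j.+1 z]].

Let level_ge n : L <= level n.
Proof. by have g0 := g_gt0; rewrite lerDl mulr_ge0// divr_ge0// ltW. Qed.

Let p2 : 4 <= 2 / beta.
Proof.
have B0 := B_gt0; have g0 := g_gt0; have g1 := g_le1.
rewrite /beta invf_div mulrA ler_pdivlMr//; nra.
Qed.

Let good_jump n : good n -> [/\ L <= Re (u n z), 0 <= Re (u n z),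
  Re (u n z) + 8 <= jump (Re (u n z)) & B / s <= jump (Re (u n z))].
Proof.
move=> [_ H]; have xL : L <= Re (u n z) by apply: le_trans H.
have x0 := le_trans L_ge0 xL; have := jumpL xL.
have : 0 < B / s by rewrite divr_gt0// B_gt0.
have := p2; move: (2 / beta) => p p4 Bs H1; split=> //; nra.
Qed.

Let exp_jump n : good n -> B * expR (- jump (Re (u n z))) <= s.
Proof.
move=> /good_jump[_ _ _ J]; have s0 := s_gt0; have B0 := B_gt0.
have H : B / s <= expR (jump (Re (u n z))).
  by apply: le_trans J _; have := expR_ge1Dx (jump (Re (u n z))); lra.
by rewrite expRN ler_pdivrMr ?expR_gt0// mulrC -ler_pdivrMr.
Qed.

Let plunged_small n : good n -> plunged n ->
  nc (u n.+2 z) <= s /\ - 1 <= Re (u n.+2 z).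
Proof.
move=> G P; have H : nc (u n.+2 z) <= s by apply: le_trans P (exp_jump G).
split=> //; have := le_trans (Re_le_nc _) H; rewrite ler_norml => /andP[? _].
have := s_le; lra.
Qed.

(** Leaving the strip means that |y| has grown from at most B e^(-J) to s, where J is the jump. By
    [run_Im_exp] this forces (x' + 1) / beta >= J - B / s, hence x' + 1 >= 2 (x_n + 2). Averaging
    with the gain x' >= -1 + g j of the run puts x' above the level. *)
Let exit_good n j : (n0 <= n)%N -> good n -> plunged n -> run n.+2 j z ->
  s <= `|Im (u (n.+2 + j)%N z)| -> good (n.+2 + j)%N.
Proof.
move=> n0n G P Hr sY; split=> //.
have [us xm] := plunged_small G P; have [_ x0 J1 J2] := good_jump G.
have [sYn xn] := G; have B0 := B_gt0; have s0 := s_gt0; have b0 := beta_gt0.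
have [xL _ _ _] := good_jump G; have J3 := jumpL xL.
have H1 := run_Re Hr; have H2 := run_Im_exp Hr.
set m := n.+2 in us xm H1 H2 *; set x' := Re (u (m + j)%N z) in H1 H2 *.
set J := jump _ in J1 J2 J3.
have H3 : J - B / s <= (x' + 1) / beta.
  rewrite leNgt; apply/negP => H3.
  have : s <= B * expR (- J) * expR ((x' + 1) / beta).
    apply: le_trans sY _; apply: le_trans H2 _.
    apply: ler_pM; [exact: nc_ge0|exact: expR_ge0|exact: P|].
    by rewrite ler_expR ler_pM2r ?invr_gt0//; lra.
  rewrite -mulrA -expRD => H4.
  have H5 : - J + (x' + 1) / beta < - (B / s) by lra.
  have H6 : s < B * expR (- (B / s)).
    by apply: le_lt_trans H4 _; rewrite ltr_pM2l// ltr_expR.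
  move: H6; apply/negP; rewrite -leNgt expRN ler_pdivrMr ?expR_gt0//.
  rewrite mulrC -ler_pdivrMr//.
  by have := expR_ge1Dx (B / s); lra.
have H4 : beta * (J - B / s) <= x' + 1.
  by rewrite mulrC -ler_pdivlMr.
have H5 : 2 * (Re (u n z) + 2) <= beta * (J - B / s).
  have : beta * (2 / beta * (Re (u n z) + 2)) <= beta * (J - B / s).
    by rewrite ler_pM2l//; lra.
  by rewrite mulrA [beta * _]mulrC mulfVK// gt_eqF.
have -> : level (m + j) = level n + g / 2 * (j.+2)%:R.
  rewrite /level -addrA -mulrDr -natrD; congr (_ + _ * _%:R).
  by rewrite /m !addSnnS addnBAC.
rewrite (_ : j.+2%:R = j%:R + 2); last by rewrite -natrD addn2.
by have := g_le1; lra.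
Qed.

Let state_step t : (n0 <= t)%N -> state t -> state t.+1.
Proof.
have s0 := s_gt0; have s4 := s_le; have g0 := g_gt0; have g1 := g_le1.
have B0 := B_gt0.
move=> n0t [G|[n [-> n0n G xM]]|[n [j [-> n0n G P Hr]]]].
- have [xL x0 J1 J2] := good_jump G.
  have [|HRe HIm] := @jump_step t z.
    apply: le_lt_trans (no_failure n0t G); rewrite ler_expR; have [_ ?] := G; lra.
  have [x'0|x'0] := leP 0 (Re (u t.+1 z)).
    apply: Or31; split; first lra.
    rewrite ger0_norm// in HRe.
    have -> : level t.+1 = level t + g / 2 by rewrite /level subSn// -natr1; ring.
    have [_ ?] := G; lra.
  apply: Or32; exists t; split=> //.
  by rewrite ltr0_norm// in HRe; lra.
- have P : plunged n.
    rewrite /plunged nc_orbS//; apply: ler_pM; rewrite ?expR_ge0//; first exact: ltW.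
    by rewrite ler_expR.
  have [us _] := plunged_small G P.
  have [sY|sY] := leP s `|Im (u n.+2 z)|.
    apply: Or31; have := @exit_good n 0%N n0n G P; rewrite addn0; apply=> //.
  apply: Or33; exists n, 0%N; rewrite addn0; split=> // i.
  by rewrite ltnS leqn0 => /eqP ->; rewrite addn0.
- have [sY|sY] := leP s `|Im (u (n.+2 + j.+1)%N z)|.
    by rewrite -addnS; apply: Or31; exact: exit_good.
  by rewrite -addnS; apply: Or33; exists n, j.+1; split=> //; exact: runS.
Qed.

Lemma state_all t : (n0 <= t)%N -> state t.
Proof.
move=> /subnK <-; elim: (t - n0)%N => [|i IH]; first exact: Or31.
by rewrite addSn; apply: state_step => //; exact: leq_addl.
Qed.

(** At good times x exceeds the level, and after a jump to the left x is very negative: both are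
    close to infinity. During a run, if x is still below K = 1/e then the run is short, since it
    gains g per step from at least -1; so it began late, |u_(n+2)| is tiny, and the shadowing error
    is at most e. *)
Lemma itinerary_near (e : R) : 0 < e ->
  exists N, forall t, (N <= t)%N -> near_postsingular e t z.
Proof.
move=> e0; pose K := e^-1; have K0 : 0 < K by rewrite invr_gt0.
have B0 := B_gt0; have g0 := g_gt0; have b0 := beta_gt0; have L0 := L_ge0.
pose E := B * expR ((K + 1) / beta); have E0 : 0 < E by rewrite mulr_gt0// expR_gt0.
pose m := Num.min e 8^-1; have m0 : 0 < m by rewrite lt_min e0 invr_gt0 ltr0n.
(* The summand K serves the first two cases; E / m makes the shadowing error at most m. *)
pose thr := K + E / m; have Em0 : 0 < E / m by rewrite divr_gt0.
pose J := (Num.truncn ((1 + K) / g)).+1.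
pose N1 := (Num.truncn (2 * thr / g)).+1.
exists (n0 + N1 + J + 2)%N => t /itinerary_index[n0t tN tN1 tN2].
have level_thr n : (n0 + N1 <= n)%N -> thr <= level n.
  move=> Nn; have : (N1%:R : R) <= (n - n0)%:R by rewrite ler_nat leq_subRL// (leq_trans (leq_addr N1 n0)).
  have : 2 * thr / g < N1%:R by rewrite /N1; exact: truncnS_gt.
  rewrite ltr_pdivrMr// /level => H1 H2.
  have : g * N1%:R <= g * (n - n0)%:R by rewrite ler_pM2l.
  lra.
case: (state_all n0t) => [[_ xt]|[n [tE n0n G xt]]|[n [j [tE n0n G P Hr]]]].
- left; apply: le_trans (ler_norm _); apply: le_trans xt.
  by apply: le_trans (level_thr t _); [rewrite /thr -/K; lra|].
- left; rewrite ler0_norm; last first.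
    by have [_ x0 J1 _] := good_jump G; apply: le_trans xt _; lra.
  have [_ x0 J1 _] := good_jump G; have [_ xn] := G.
  have : thr <= level n by apply: level_thr; exact: tN1.
  rewrite /thr -/K; lra.
- have [xK|xK] := leP K (Re (u t z)).
    by left; apply: le_trans (ler_norm _).
  right; exists j; first by rewrite tE leq_addl.
  have [us xm] := plunged_small G P; have [_ x0 J1 _] := good_jump G.
  have Hr' := runW Hr; rewrite tE in xK.
  have jJ : (j < J)%N.
    rewrite -(ltr_nat R); apply: (@lt_trans _ _ ((1 + K) / g)); last first.
      by rewrite /J; exact: truncnS_gt.
    by rewrite ltr_pdivlMr//; have := run_Re Hr'; lra.
  have xthr : thr <= Re (u n z).
    by have [_ xn] := G; apply: le_trans xn; apply: level_thr; exact: tN2 tE jJ.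
  have small : nc (u n.+2 z) *
      expR ((Re (u (n.+2 + j)%N z) - Re (u n.+2 z)) / beta) <= m.
    apply: (@le_trans _ _ (B * expR (- jump (Re (u n z))) * expR ((K + 1) / beta))).
      apply: ler_pM; [exact: nc_ge0|exact: expR_ge0|exact: P|].
      by rewrite ler_expR ler_pM2r ?invr_gt0//; lra.
    rewrite mulrAC -/E expRN ler_pdivrMr ?expR_gt0// mulrC -ler_pdivrMr//.
    have := expR_ge1Dx (jump (Re (u n z))); rewrite /thr in xthr; lra.
  have m1 : m <= e by rewrite ge_min lexx.
  have m2 : m <= 8^-1 by rewrite ge_min lexx orbT.
  rewrite tE addnK.
  by apply: le_trans (run_shadow_exp Hr' (le_trans small m2)) _; exact: le_trans m1.
Qed.

End Itinerary.

End Chain.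

(** * Measure of the failures *)

Section Failure.
Variable R : realType.
Local Notation plane := (measurableTypeR R * measurableTypeR R)%type.
Local Notation mu := (@lebesgue_measure R \x @lebesgue_measure R)%E.
Local Notation nc := (@Normc.normc R).
Local Notation Re := complex.Re.
Local Notation Im := complex.Im.
Variables (a : nat -> R) (s T : R).
Hypothesis a_gt0 : forall n, 0 < a n.
Hypotheses (s_gt0 : 0 < s) (T_gt0 : 0 < T).
Hypothesis sderT : forall n z,
  `|complex.Im (orb a n z)| * sder a n z <= T * der a n z.
Local Notation x_ n p := (Re (orb a n (pt p))).
Local Notation y_ n p := (Im (orb a n (pt p))).
Local Notation kappa := (kappa s T).

Definition failure (l d : R) n : set plane :=
  [set p | [/\ s <= `|y_ n p|, l <= x_ n p & `|sin (y_ n p *+ 2)| <= d]].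

Lemma measurable_failure l d n : measurable (failure l d n).
Proof.
have [mRe mIm] := measurable_orb a n.
have -> : failure l d n = [set p : plane | `|y_ n p| \in `[s, +oo[] `&`
    ([set p | x_ n p \in `[l, +oo[] `&` [set p | `|sin (y_ n p *+ 2)| \in `]-oo, d]]).
  apply/seteqP; split=> p; rewrite /failure /= !in_itv/= ?andbT.
    by move=> [].
  by move=> [? []].
apply: measurableI; first by apply: measurable_level; exact: measurableT_comp mIm.
apply: measurableI; first exact: measurable_level.
apply: measurable_level; apply: measurableT_comp => //.
have -> : (fun p : plane => sin (y_ n p *+ 2)) = sin \o (fun p => y_ n p + y_ n p).
  by [].
apply: measurableT_comp; last exact: measurable_funD.
by apply: continuous_measurable_fun; exact: continuous_sin.
Qed.

Let cell (x0 d : R) n (X : set plane) i : set plane :=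
  X `&` [set p | i%:R * d <= x_ n p - x0 < i.+1%:R * d].

(* At time [n] the failing points near [p] lie in a horizontal strip of width [2 d]. *)
Lemma failure_spread l d n (p w w' : plane) (m : R) : 0 < d ->
  s <= `|y_ n p| ->
  failure l d n w -> failure l d n w' -> m * der a n (pt p) <= kappa / 2 ->
  nc (pt w - pt p) <= 2 * m -> nc (pt w' - pt p) <= 2 * m -> nc (pt w' - pt w) <= 2 * m ->
  `|x_ n w - x_ n p| <= 4^-1 /\
  nc (pt w' - pt w) * der a n (pt p) <= 4 * (`|x_ n w' - x_ n w| + 2 * d).
Proof.
move=> d0 sp [sw _ dw] [_ _ dw'] mk wp w'p w'w.
have k8 := kappa_le s T; have k0 := kappa_gt0 s_gt0 T_gt0.
have D0 := der_gt0 a_gt0 n (pt p).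
have wp' : nc (pt w - pt p) * der a n (pt p) <= kappa.
  have : nc (pt w - pt p) * der a n (pt p) <= 2 * m * der a n (pt p) by rewrite ler_pM2r.
  lra.
have w'p' : nc (pt w' - pt p) * der a n (pt p) <= kappa.
  have : nc (pt w' - pt p) * der a n (pt p) <= 2 * m * der a n (pt p) by rewrite ler_pM2r.
  lra.
have [|H1 _ H2 H3] := good_distortion a_gt0 s_gt0 T_gt0 sderT (w := pt w) sp; first lra.
have [|H1' _ _ _] := good_distortion a_gt0 s_gt0 T_gt0 sderT (w := pt w') sp; first lra.
have w0 := nc_ge0 (pt w' - pt w).
have ww : nc (pt w' - pt w) * der a n (pt w) <= 2 * kappa.
  have : nc (pt w' - pt w) * der a n (pt w) <= nc (pt w' - pt w) * (2 * der a n (pt p)).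
    by rewrite ler_wpM2l.
  have : nc (pt w' - pt w) * der a n (pt p) <= 2 * m * der a n (pt p) by rewrite ler_pM2r.
  lra.
have [_ H4 _ _] := good_distortion a_gt0 s_gt0 T_gt0 sderT (w := pt w') sw ww.
have yw : `|y_ n w - y_ n p| <= 4^-1.
  have := Im_le_nc (orb a n (pt w) - orb a n (pt p)); rewrite ImB; lra.
have yw' : `|y_ n w' - y_ n p| <= 4^-1.
  have := Im_le_nc (orb a n (pt w') - orb a n (pt p)); rewrite ImB; lra.
split.
  have := Re_le_nc (orb a n (pt w) - orb a n (pt p)); rewrite ReB; lra.
have yy : `|y_ n w' - y_ n w| <= 2 * d.
  set y' := y_ n w' in dw' yw' *; set y := y_ n w in dw yw *.
  have small : `|(y' - y) *+ 2| <= 1.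
    rewrite -(mulr_natl (y' - y)) normrM normr_nat.
    have := ler_normB (y' - y_ n p) (y - y_ n p).
    have -> : y' - y_ n p - (y - y_ n p) = y' - y by ring.
    lra.
  have H5 := norm_le_2sin small.
  rewrite [in sin _]mulrnBl sinB in H5.
  have : `|sin (y' *+ 2) * cos (y *+ 2) - cos (y' *+ 2) * sin (y *+ 2)| <= 2 * d.
    apply: le_trans (ler_normB _ _) _; rewrite !normrM.
    have := cos_max (y *+ 2); have := cos_max (y' *+ 2).
    have := normr_ge0 (sin (y *+ 2)); have := normr_ge0 (sin (y' *+ 2)).
    have := normr_ge0 (cos (y *+ 2)); have := normr_ge0 (cos (y' *+ 2)).
    by nra.
  rewrite -(mulr_natl (y' - y)) normrM normr_nat in H5; lra.
have := nc_le_l1 (orb a n (pt w') - orb a n (pt w)); rewrite ReB ImB => H6.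
have : nc (pt w' - pt w) * der a n (pt p) <= nc (pt w' - pt w) * (2 * der a n (pt w)).
  by rewrite ler_wpM2l.
lra.
Qed.

(** The failing points are cut into cells on which x_n varies by at most d. By [failure_spread] a
    cell has radius at most 4 (d + 2 d) / D_n = 12 d / D_n, and at most 3 / d cells occur: 576 (d /
    D_n)^2 times 3 / d gives 1728 d / D_n^2. *)
Lemma strip_measure : exists2 C : R, 0 < C & forall l d n (p : plane) k c,
  0 < d -> d <= 1 -> s <= `|y_ n p| ->
  square k c p -> mesh R k * der a n (pt p) <= kappa / 2 ->
  (mu (failure l d n `&` square k c) <= (C * d / der a n (pt p) ^+ 2)%:E)%E.
Proof.
exists 1728; first lra.
move=> l d n p k c d0 d1 sp sqp mk; pose X := failure l d n `&` square k c.
have D0 := der_gt0 a_gt0 n (pt p); set D := der a n (pt p) in mk D0 *.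
pose x0 := x_ n p - 1.
pose C i := cell x0 d n X i.
pose r := 12 * d / D; have r0 : 0 < r by rewrite divr_gt0// mulr_gt0.
have spread w w' : X w -> X w' -> `|x_ n w - x_ n p| <= 4^-1 /\
    nc (pt w' - pt w) * D <= 4 * (`|x_ n w' - x_ n w| + 2 * d).
  move=> [Fw sw] [Fw' sw']; apply: (failure_spread d0 sp Fw Fw' mk).
  - exact: square_dist sqp sw.
  - exact: square_dist sqp sw'.
  - exact: square_dist sw sw'.
have [ctr Hctr] : exists ctr : nat -> plane, forall i w, C i w ->
    nc (pt w - pt (ctr i)) <= r.
  have H i : exists v : plane, forall w, C i w -> nc (pt w - pt v) <= r.
    (* The centre of an empty cell is arbitrary. *)
    have [[v [Xv /andP[v1 v2]]]|no] := pselect (exists v, C i v); last first.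
      by exists p => w Cw; exfalso; apply: no; exists w.
    exists v => w [Xw /andP[w1 w2]]; have [_ H] := spread v w Xv Xw.
    rewrite ler_pdivlMr//; apply: (le_trans H).
    have : `|x_ n w - x_ n v| <= d.
      by rewrite -natr1 in v2 w2; rewrite ler_norml; apply/andP; split; lra.
    lra.
  by exists (fun i => sval (cid (H i))) => i; case: (cid (H i)).
pose Rc i : set plane := `[(ctr i).1 - r, (ctr i).1 + r] `*` `[(ctr i).2 - r, (ctr i).2 + r].
have mRc i : measurable (Rc i) by apply: measurableX; exact: measurable_itv.
have muRc i : (mu (Rc i) = ((2 * r) ^+ 2)%:E)%E.
  by rewrite rectangle_measure; [congr (_%:E); ring|lra|lra].
pose N := (Num.truncn (2 / d)).+1.
have XRc : X `<=` \big[setU/set0]_(i < N) Rc i.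
  move=> w Xw; have [xw _] := spread w w Xw Xw.
  have xw' : 0 <= x_ n w - x0 <= 2.
    by move: xw; rewrite /x0 ler_norml => /andP[? ?]; apply/andP; split; lra.
  pose i := Num.truncn ((x_ n w - x0) / d).
  have /andP[w0 w2] := xw'.
  have iE : i%:R * d <= x_ n w - x0 < i.+1%:R * d.
    by rewrite -ler_pdivlMr// -ltr_pdivrMr//; apply: truncn_itv; rewrite divr_ge0// ltW.
  have iN : (i < N)%N by rewrite ltnS le_truncn// ler_pM2r ?invr_gt0.
  rewrite -bigcup_mkord; exists i => //.
  have := Hctr i w (conj Xw iE) => H.
  have := le_trans (Re_le_nc (pt w - pt (ctr i))) H.
  have := le_trans (Im_le_nc (pt w - pt (ctr i))) H.
  rewrite ReB ImB !ler_norml [Im (pt w)]/= [Im (pt _)]/= [Re (pt w)]/= [Re (pt _)]/=.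
  move=> /andP[h1 h2] /andP[h3 h4].
  by split; rewrite /= in_itv/=; apply/andP; split; lra.
have mX : measurable X.
  by apply: measurableI; [exact: measurable_failure|exact: measurable_square].
apply: (@le_trans _ _ (\sum_(i < N) mu (Rc i))%E); first exact: content_subadditive.
under eq_bigr do rewrite muRc.
rewrite sumEFin lee_fin sumr_const card_ord -(mulr_natl ((2 * r) ^+ 2)).
have Nd : N%:R * d <= 3.
  rewrite /N -natr1 mulrDl mul1r.
  have : (Num.truncn (2 / d))%:R <= 2 / d by rewrite truncn_le divr_ge0// ltW.
  rewrite ler_pdivlMr//; lra.
rewrite ler_pdivlMr ?exprn_gt0// /r.
have -> : N%:R * (2 * (12 * d / D)) ^+ 2 * D ^+ 2 = 576 * (N%:R * d) * d.
  by field; rewrite gt_eqF.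
by nra.
Qed.

(** Each failing point lies in a subsquare of size comparable to 1 / D_n, or to the given square if
    that is smaller; there [strip_measure] gives density at most a constant times d.
    [sparse_measure_le] carries this density to the given square. *)
Lemma failure_sparse (h : R) : 0 < h -> exists2 K : R, 0 < K &
  forall l d n0 n k c, 0 < d -> d <= 1 -> (n0 <= n)%N ->
  (forall p, square k c p -> s <= `|y_ n0 p| /\ h <= mesh R k * der a n0 (pt p)) ->
  (mu (failure l d n `&` square k c) <= (K * d)%:E * mu (square k c))%E.
Proof.
move=> h0; have s0 := s_gt0; have T0 := T_gt0; have k0 := kappa_gt0 s_gt0 T_gt0.
have [C0 C00 strip] := strip_measure.
(* At a good time n > n0, D_n >= (s / T) D_n0; the 1 is for n = n0. *)
pose c1 := Num.min 1 (s / T); have c10 : 0 < c1 by rewrite lt_min ltr01 divr_gt0.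
(* A lower bound for mesh times D_n in the subsquare; the final half is lost in rounding to a dyadic
   mesh. *)
pose h3 := Num.min (c1 * h) (kappa / 2) / 2.
have h30 : 0 < h3 by rewrite divr_gt0// lt_min mulr_gt0//= divr_gt0.
exists (C0 / h3 ^+ 2); first by rewrite divr_gt0// exprn_gt0.
move=> l d n0 n k c d0 d1 n0n Hsq.
pose X := failure l d n `&` square k c.
have mX : measurable X.
  by apply: measurableI; [exact: measurable_failure|exact: measurable_square].
apply: (@sparse_measure_le _ X (square k c)) => //.
- by rewrite mulr_ge0 ?divr_ge0 ?exprn_ge0// ltW.
- exact: measurable_square.
move=> p [Fp sqp]; have [sY0 hD] := Hsq p sqp; have [sY _ _] := Fp.
have D0 := der_gt0 a_gt0 n (pt p).
have D00 := der_gt0 a_gt0 n0 (pt p).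
have Dle : c1 * der a n0 (pt p) <= der a n (pt p).
  move: n0n; rewrite leq_eqVlt => /orP[/eqP <-|n0n].
    by rewrite ger_pMl// ge_min lexx.
  apply: (@le_trans _ _ (s / T * der a n0 (pt p))).
    by rewrite ler_pM2r// ge_min lexx orbT.
  rewrite mulrAC ler_pdivrMr// [leRHS]mulrC.
  apply: le_trans (good_sder a_gt0 sderT sY).
  by rewrite ler_pM2l//; exact: der_le_sder.
set D := der a n (pt p) in D0 Dle.
have m0 := mesh_gt0 R k.
pose r := Num.min (mesh R k) (kappa / 2 / D).
have r0 : 0 < r by rewrite lt_min m0 /= !divr_gt0.
have r1 : r <= 1.
  apply: (@le_trans _ _ (mesh R k)); first by rewrite ge_min lexx.
  by rewrite exprn_ile1//; lra.
have [k' mk1 mk2] := mesh_between r0 r1.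
have [c' sq'] := square_exists k' p.
have rk : r <= mesh R k by rewrite ge_min lexx.
have kk' : (k <= k')%N.
  rewrite leqNgt; apply/negP => k'k.
  have : mesh R k < mesh R k'.
    by rewrite /mesh ltr_iXn2l//; lra.
  lra.
have sub : @square R k' c' `<=` square k c.
  have ff : square (R := R) k' c' `&` square k c !=set0 by exists p.
  exact: finer_square (square_finer kk' ff).
exists k', c'; split=> //.
have mkD : mesh R k' * D <= kappa / 2.
  rewrite -ler_pdivlMr//; apply: le_trans mk1 _.
  by rewrite ge_min lexx orbT.
have -> : X `&` square k' c' = failure l d n `&` square k' c'.
  by rewrite /X -setIA (setIidr sub).
apply: le_trans (strip l _ _ _ _ _ d0 d1 sY sq' mkD) _.
rewrite square_measure -EFinM lee_fin -/D.
have h3D : h3 <= mesh R k' * D.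
  have : Num.min (c1 * h) (kappa / 2) <= r * D.
    rewrite /r; have [_|_] := leP (mesh R k) (kappa / 2 / D).
      apply: (@le_trans _ _ (c1 * h)); first by rewrite ge_min lexx.
      apply: (@le_trans _ _ (mesh R k * (c1 * der a n0 (pt p)))).
        by rewrite mulrCA ler_pM2l.
      by rewrite ler_pM2l.
    by rewrite mulfVK ?gt_eqF// ge_min lexx orbT.
  rewrite /h3; have : r * D <= 2 * mesh R k' * D by rewrite ler_pM2r.
  lra.
rewrite ler_pdivrMr ?exprn_gt0//.
have -> : C0 / h3 ^+ 2 * d * mesh R k' ^+ 2 * D ^+ 2 =
  C0 * d * ((mesh R k' * D) ^+ 2 / h3 ^+ 2) by ring.
apply: ler_peMr; first by rewrite mulr_ge0// ltW.
rewrite ler_pdivlMr ?exprn_gt0// mul1r.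
by rewrite ler_sqr ?nnegrE//; lra.
Qed.

End Failure.

(** * Almost every orbit is eventually near the orbit of 0 or near infinity *)

Section Wandering.
Variable R : realType.
Local Notation plane := (measurableTypeR R * measurableTypeR R)%type.
Local Notation mu := (@lebesgue_measure R \x @lebesgue_measure R)%E.
Local Notation nc := (@Normc.normc R).
Local Notation Re := complex.Re.
Local Notation Im := complex.Im.
Variables (a : nat -> R) (A B s g T : R).
Hypothesis A_gt0 : 0 < A.
Hypothesis a_gt0 : forall n, 0 < a n.
Hypothesis a_ge : forall n, A <= a n.
Hypothesis a_le : forall n, a n <= B.
Hypotheses (s_gt0 : 0 < s) (s_le : s <= 4^-1) (g_gt0 : 0 < g) (g_le1 : g <= 1).
Hypothesis growth : forall alpha x y : R, A <= alpha -> `|y| <= 2 * s ->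
  expR (x - 1 + g) <= alpha * expR x * cos y.
Hypothesis T_gt0 : 0 < T.
Hypothesis sderT : forall n z,
  `|complex.Im (orb a n z)| * sder a n z <= T * der a n z.
Local Notation x_ n p := (Re (orb a n (pt p))).
Local Notation y_ n p := (Im (orb a n (pt p))).
Local Notation kappa := (kappa s T).

(** The negation of [near_postsingular], spelled out with strict inequalities to show that it is an
    open condition. *)
Definition off_postsingular (e : R) n : set plane := [set p | `|x_ n p| < e^-1 /\
  forall k, (k <= n)%N -> e < nc (orb a n (pt p) - orb (shift a (n - k)) k 0)].

Lemma off_postsingularP e n p :
  off_postsingular e n p <-> ~ near_postsingular a e n (pt p).
Proof.
split=> [[H1 H2] [H|[k kn]]|H].
- by move: H; rewrite leNgt H1.
- by rewrite leNgt H2.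
split=> [|k kn]; rewrite ltNge; apply/negP => H'; apply: H; first by left.
by right; exists k.
Qed.

Lemma measurable_off_postsingular e n : 0 < e -> measurable (off_postsingular e n).
Proof.
move=> e0; have [mRe mIm] := measurable_orb a n.
pose f k (p : plane) : R := (x_ n p - Re (orb (shift a (n - k)) k 0)) ^+ 2 +
  (y_ n p - Im (orb (shift a (n - k)) k 0)) ^+ 2.
have mf k : measurable_fun [set: plane] (f k).
  by apply: measurable_funD; apply: measurable_funX; exact: measurable_funB.
have -> : off_postsingular e n = [set p : plane | `|x_ n p| \in `]-oo, e^-1[] `&`
    \bigcap_(k in [set k | (k <= n)%N]) [set p | f k p \in `]e ^+ 2, +oo[].
  have H k p : (e < nc (orb a n (pt p) - orb (shift a (n - k)) k 0)) =
      (f k p \in `]e ^+ 2, +oo[).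
    by rewrite in_itv/= andbT ltNge (nc_leP _ (ltW e0)) ReB ImB -ltNge.
  apply/seteqP; split=> p [p1 p2]; split.
  - by rewrite /= in_itv.
  - by move=> k kn; rewrite /= -H; exact: p2.
  - by move: p1; rewrite /= in_itv.
  - by move=> k kn; rewrite H; exact: p2.
apply: measurableI; first by apply: measurable_level; exact: measurableT_comp mRe.
by apply: bigcap_measurableType => k _; exact: measurable_level.
Qed.

Lemma margin_exists n (e : R) (f : nat -> R) : (forall k, (k <= n)%N -> e < f k) ->
  exists2 m, 0 < m & forall k, (k <= n)%N -> e + m <= f k.
Proof.
elim: n => [|n IH] H.
  exists (f 0%N - e); first by rewrite subr_gt0 H.
  by move=> k; rewrite leqn0 => /eqP ->; lra.
have [|m m0 Hm] := IH; first by move=> k kn; apply: H; exact: leqW.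
have fn := H n.+1 (leqnn _).
exists (Num.min m (f n.+1 - e)); first by rewrite lt_min m0 subr_gt0.
have m1 : Num.min m (f n.+1 - e) <= m by rewrite ge_min lexx.
have m2 : Num.min m (f n.+1 - e) <= f n.+1 - e by rewrite ge_min lexx orbT.
move=> k; rewrite leq_eqVlt => /orP[/eqP ->|kn]; first lra.
by have := Hm k kn; lra.
Qed.

Lemma off_postsingular_open e n p : off_postsingular e n p ->
  exists2 r : R, 0 < r & forall q, nc (pt q - pt p) <= r -> off_postsingular e n q.
Proof.
move=> [p1 p2]; have [m m0 Hm] := margin_exists p2.
pose m' := Num.min (m / 2) ((e^-1 - `|x_ n p|) / 2).
have m'0 : 0 < m' by rewrite lt_min !divr_gt0//= subr_gt0.
have m'1 : m' <= m / 2 by rewrite ge_min lexx.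
have m'2 : m' <= (e^-1 - `|x_ n p|) / 2 by rewrite ge_min lexx orbT.
have [r r0 Hr] := orb_continuous a_gt0 n (pt p) m'0.
exists r => // q /Hr /(_ n (leqnn n)) H; split.
  have := Re_le_nc (orb a n (pt q) - orb a n (pt p)); rewrite ReB => H1.
  have := ler_normD (x_ n q - x_ n p) (x_ n p); rewrite subrK.
  by move: (e^-1) p1 m'2 => e' *; lra.
move=> k kn; have := Hm k kn; set w := orb _ k 0 => H2.
have := nc_triangleB (orb a n (pt p) - w) (orb a n (pt q) - orb a n (pt p)).
have -> : orb a n (pt p) - w + (orb a n (pt q) - orb a n (pt p)) = orb a n (pt q) - w.
  by ring.
lra.
Qed.

Definition wandering (e : R) : set plane :=
  \bigcap_j \bigcup_(n in [set n | (j <= n)%N]) off_postsingular e n.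

Lemma measurable_wandering e : 0 < e -> measurable (wandering e).
Proof.
move=> e0; apply: bigcapT_measurable => j; apply: bigcup_measurable => n _.
exact: measurable_off_postsingular.
Qed.

Lemma wandering_off e p N : 0 < e -> wandering e p ->
  (forall n, (N <= n)%N -> near_postsingular a e n (pt p)) -> False.
Proof.
move=> e0 /(_ N I)[n Nn /off_postsingularP H] /(_ n Nn); exact: H.
Qed.

(** Far to the right, either |y| reaches 2s at a later time, with x not smaller at the first such
    time, or x grows forever and the orbit tends to infinity, which wandering excludes. The margin
    2s leaves nearby points with |y| >= s. A large derivative at an earlier good time is inherited
    up to the factor s / T. *)
Lemma far_good_time e p : 0 < e -> ~ bounded_orbit a p -> wandering e p ->
  forall (L M : R), exists n, [/\ 2 * s <= `|y_ n p|, L <= x_ n p & M <= der a n (pt p)].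
Proof.
move=> e0 nb wp; have s0 := s_gt0; have T0 := T_gt0; have g0 := g_gt0.
have far (L : R) n1 : exists n, [/\ (n1 <= n)%N, 2 * s <= `|y_ n p| & L <= x_ n p].
  have [n2 n12 xL] : exists2 n2, (n1 <= n2)%N & L <= x_ n2 p.
    apply: contrapT => H; apply: nb.
    exists (Num.truncn L).+1 => //; exists n1 => // n n1n.
    apply/ltW; apply: lt_trans (truncnS_gt L).
    by rewrite ltNge; apply/negP => H'; apply: H; exists n.
  have [good|bad] := pselect (exists i, 2 * s <= `|y_ (n2 + i)%N p|); last first.
    exfalso; pose K := e^-1 - x_ n2 p.
    apply: (@wandering_off e p (n2 + (Num.truncn (K / g)).+1) e0 wp) => n.
    move=> /subnK <-; set i := (n - _)%N; rewrite addnC -addnA; left.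
    set j := (_ + i)%N.
    have : x_ n2 p + g * j%:R <= x_ (n2 + j)%N p.
      apply: (Re_orb_run a_ge growth) => i' _; rewrite leNgt; apply/negP => H.
      by apply: bad; exists i'; exact: ltW.
    have : K / g < j%:R.
      apply: (lt_le_trans (truncnS_gt _)); by rewrite ler_nat leq_addr.
    rewrite ltr_pdivrMr// => H1 H2; apply: le_trans (ler_norm _).
    by move: H1; rewrite /K; move: (e^-1) => e'; lra.
  pose P i := 2 * s <= `|y_ (n2 + i)%N p|.
  have exP : exists i, P i by [].
  have [i Pi imin] := ex_minnP exP; exists (n2 + i)%N; split=> //.
    exact: leq_trans n12 (leq_addr _ _).
  have : x_ n2 p + g * i%:R <= x_ (n2 + i)%N p.
    apply: (Re_orb_run a_ge growth) => i' ii'; rewrite leNgt; apply/negP => H.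
    by have := imin i' (ltW H); rewrite leqNgt ii'.
  have : 0 <= g * i%:R by rewrite mulr_ge0// ltW.
  lra.
move=> L M.
have inf n1 : exists2 n, (n1 <= n)%N & s <= `|y_ n p|.
  by have [n [? ? _]] := far 0 n1; exists n => //; lra.
have [n' [_ _ Mn']] := good_der_large a_gt0 s_gt0 T_gt0 sderT (M * T / s) 0 inf.
have [n [n'n yn xn]] := far L n'.+1; exists n; split=> //.
have sy : s <= `|y_ n p| by lra.
have := good_sder a_gt0 sderT sy; have := der_le_sder a_gt0 (pt p) n'n => H1 H2.
rewrite ler_pdivrMr// in Mn'.
rewrite -(@ler_pM2l _ T)// [leLHS]mulrC; apply: (le_trans Mn').
by apply: le_trans H2; rewrite mulrC ler_pM2l.
Qed.

Lemma geometric_sum_le (r : R) n : 0 < r < 1 -> \sum_(i < n) r ^+ i <= (1 - r)^-1.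
Proof.
move=> /andP[r0 r1]; rewrite -[leRHS]mul1r ler_pdivlMr; last lra.
have -> : (\sum_(i < n) r ^+ i) * (1 - r) = 1 - r ^+ n.
  elim: n => [|n IH]; first by rewrite big_ord0 mul0r expr0 subrr.
  by rewrite big_ord_recr /= mulrDl IH exprSr; ring.
have H : 0 <= r ^+ n by rewrite exprn_ge0// ltW.
by lra.
Qed.

Let r0 : R := expR (- (g / 4)).

Let r0_itv : 0 < r0 < 1.
Proof. by rewrite expR_gt0 expR_lt1 oppr_lt0 divr_gt0. Qed.

Lemma level_exp (L : R) n0 i :
  expR (- (level g L n0 (n0 + i) / 2)) = expR (- (L / 2)) * r0 ^+ i.
Proof.
rewrite /r0 -expRM_natl -expRD /level addKn; congr expR; lra.
Qed.

(** By [failure_sparse] the densities at times n0 + i are at most K e^(-L/2) r0^i, with sum at most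
    K e^(-L/2) / (1 - r0). As L e^(-L/2) <= 2, L >= 4 K / (1 - r0) makes this at most 1/2. *)
Lemma failures_sparse (h : R) : 0 < h -> exists2 L1 : R, 0 < L1 & forall L n0 k c,
  L1 <= L ->
  (forall p, square k c p -> s <= `|y_ n0 p| /\ h <= mesh R k * der a n0 (pt p)) ->
  (mu ((\bigcup_i failure a s (level g L n0 (n0 + i)%N)
     (expR (- (level g L n0 (n0 + i)%N / 2))) (n0 + i)) `&` square k c) <=
   2^-1%:E * mu (square k c))%E.
Proof.
move=> h0; have [K K0 HK] := failure_sparse a_gt0 s_gt0 T_gt0 sderT h0.
have /andP[r00 r01] := r0_itv.
exists (4 * K / (1 - r0)); first by rewrite divr_gt0 ?mulr_gt0// subr_gt0.
move=> L n0 k c LL Hsq.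
have L0 : 0 < L by apply: lt_le_trans LL; rewrite divr_gt0 ?mulr_gt0// subr_gt0.
pose F i := failure a s (level g L n0 (n0 + i)%N)
  (expR (- (level g L n0 (n0 + i)%N / 2))) (n0 + i) `&` square k c.
have mF i : measurable (F i).
  by apply: measurableI; [exact: measurable_failure|exact: measurable_square].
rewrite -/(F _) setI_bigcupl.
have mU : measurable (\bigcup_i F i) by exact: bigcupT_measurable.
apply: (@le_trans _ _ (\sum_(i <oo) mu (F i))%E).
  exact: measure_sigma_subadditive.
pose d := expR (- (L / 2)); have d0 : 0 < d by exact: expR_gt0.
have FK i : (mu (F i) <= (K * d * r0 ^+ i * mesh R k ^+ 2)%:E)%E.
  rewrite /F level_exp -/d.
  have := HK (level g L n0 (n0 + i)%N) (d * r0 ^+ i) n0 (n0 + i)%N k c.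
  rewrite square_measure -EFinM (mulrA K); apply=> //.
  - by rewrite mulr_gt0// exprn_gt0.
  - by apply: mulr_ile1; [exact: ltW|rewrite exprn_ge0// ltW|
      rewrite /d expR_le1; lra|rewrite exprn_ile1// ltW].
  - exact: leq_addr.
apply: lime_le; first by apply: is_cvg_nneseries => i _ _; exact: measure_ge0.
apply: nearW => N.
apply: (@le_trans _ _ (\sum_(0 <= i < N) (K * d * r0 ^+ i * mesh R k ^+ 2)%:E)%E).
  by apply: lee_sum => i _; exact: FK.
rewrite sumEFin square_measure -EFinM lee_fin -mulr_suml.
apply: ler_wpM2r; first by rewrite exprn_ge0// ltW// mesh_gt0.
rewrite -mulr_sumr big_mkord.
have S := geometric_sum_le N r0_itv.
have dL : d * L <= 2.
  rewrite /d expRN mulrC ler_pdivrMr ?expR_gt0//.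
  by have := expR_ge1Dx (L / 2); lra.
apply: (@le_trans _ _ (K * d * (1 - r0)^-1)).
  by rewrite ler_wpM2l// mulr_ge0// ltW.
have : d * (4 * K / (1 - r0)) <= d * L by rewrite ler_pM2l.
have -> : d * (4 * K / (1 - r0)) = 4 * (K * d * (1 - r0)^-1) by ring.
lra.
Qed.

(** Around a wandering point with unbounded real part, a square of size about 1 / D_n0 is chosen at
    a far good time. A point of it that never fails follows the itinerary and does not wander, so
    wandering points lie among the failures, of density at most 1/2; [sparse_null] concludes. *)
Lemma wandering_null_box e M : 0 < e -> mu (box M `&` wandering e) = 0%E.
Proof.
move=> e0; have s0 := s_gt0; have k0 := kappa_gt0 s_gt0 T_gt0; have k8 := kappa_le s T.
pose V j : set plane := box M `&`
  \bigcup_(n in [set n | (j <= n)%N]) off_postsingular e n.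
have mV j : measurable (V j).
  apply: measurableI; first exact: measurable_box.
  by apply: bigcup_measurable => n _; exact: measurable_off_postsingular.
have niV i j : (i <= j)%N -> V j `<=` V i.
  move=> ij p [Bp [n jn Hn]]; split=> //; exists n => //=.
  exact: leq_trans ij jn.
have VE : \bigcap_j V j = box M `&` wandering e.
  apply/seteqP; split=> p.
    by move=> H; split; [have [] := H 0%N I|move=> j _; have [] := H j I].
  by move=> [Bp Hp] j _; split=> //; exact: Hp.
(* Points within eta / D_n0 of p move by at most 2 eta <= s at time n0, so |y| stays above s when it
   is at least 2s at p; the bound by [kappa] gives bounded distortion. *)
pose eta := Num.min (s / 2) kappa.
have eta0 : 0 < eta by rewrite lt_min divr_gt0.
have eta1 : eta <= s / 2 by rewrite ge_min lexx.
have eta2 : eta <= kappa by rewrite ge_min lexx orbT.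
(* Mesh times D_n0 will be at least eta / 4 at p, and the derivative varies by a factor of at most 2
   over the square. *)
have h0 : 0 < eta / 8 by rewrite divr_gt0.
have [L1 L10 HL1] := failures_sparse h0.
have [L2 L20 HL2] := jump_large A_gt0 a_gt0 a_le s_gt0 g_gt0.
pose L := Num.max L1 L2.
have LL1 : L1 <= L by rewrite le_max lexx.
have LL2 : L2 <= L by rewrite le_max lexx orbT.
have L0 : 0 <= L by apply: le_trans LL2.
rewrite -VE; apply: (@sparse_null _ V mV niV _ (bounded_orbit a)).
- by apply: le_lt_trans (box_fin R M); apply: le_measure; rewrite ?inE;
    [exact: mV|exact: measurable_box|move=> ? []].
- exact: measurable_bounded_orbit.
- exact: (bounded_orbit_null a_gt0 a_ge a_le s_gt0 g_gt0 growth T_gt0 sderT).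
move=> p Cp nb j; have [Bp Wp] : (box M `&` wandering e) p by rewrite -VE.
have [n jn On] := Wp j I.
have [r1 r10 Hr1] := box_open Bp.
have [r2 r20 Hr2] := off_postsingular_open On.
pose r := Num.min r1 r2; have r_gt0 : 0 < r by rewrite lt_min r10.
(* L + 1 leaves room for x >= L on the whole square, and eta / r makes the square small enough to
   lie in V j. *)
have [n0 [y0 x0 dM]] := far_good_time e0 nb Wp (L + 1) (Num.max 1 (eta / r)).
rewrite ge_max ler_pdivrMr// in dM; have /andP[d1 dr] := dM.
have d0 := lt_le_trans ltr01 d1.
have sy : s <= `|y_ n0 p| by lra.
set D := der a n0 (pt p) in d0 d1 dr.
pose rho := eta / 2 / D; have rho0 : 0 < rho by rewrite !divr_gt0.
have rhoE : rho * D = eta / 2 by rewrite /rho mulfVK// gt_eqF.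
have rho1 : rho <= 1 by rewrite ler_pdivrMr// mul1r; lra.
have [k mk1 mk2] := mesh_between rho0 rho1.
have [c sqp] := square_exists k p.
have mD1 : mesh R k * D <= eta / 2 by rewrite -rhoE ler_pM2r.
have mD2 : eta / 4 <= mesh R k * D.
  have : rho * D <= 2 * mesh R k * D by rewrite ler_pM2r.
  lra.
have dist q : square k c q -> nc (pt q - pt p) * D <= eta.
  move=> sq; have : nc (pt q - pt p) * D <= 2 * mesh R k * D.
    by rewrite ler_pM2r//; exact: square_dist sqp sq.
  lra.
have Hsq q : square k c q -> [/\ s <= `|y_ n0 q|, L <= x_ n0 q &
    eta / 8 <= mesh R k * der a n0 (pt q)].
  move=> sq; have qp := dist q sq.
  have [|H1 _ _ H2] := good_distortion a_gt0 s_gt0 T_gt0 sderT (w := pt q) sy.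
    by rewrite -/D; lra.
  have Hy := Im_le_nc (orb a n0 (pt q) - orb a n0 (pt p)); rewrite ImB in Hy.
  have Hx := Re_le_nc (orb a n0 (pt q) - orb a n0 (pt p)); rewrite ReB in Hx.
  rewrite -/D in H1 H2; split.
  - have := ler_normB (y_ n0 q) (y_ n0 q - y_ n0 p).
    have -> : y_ n0 q - (y_ n0 q - y_ n0 p) = y_ n0 p by ring.
    have s4 := s_le; lra.
  - by move: Hx; rewrite ler_norml => /andP[? _]; lra.
  - have m0 := mesh_gt0 R k.
    have : mesh R k * D <= mesh R k * (2 * der a n0 (pt q)) by rewrite ler_pM2l.
    lra.
exists k, c; split=> //.
  move=> q sq; have qr : nc (pt q - pt p) <= r.
    by rewrite -(@ler_pM2r _ D)// [leRHS]mulrC; apply: le_trans dr; exact: dist.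
  split; first by apply: Hr1; apply: le_trans qr _; rewrite ge_min lexx.
  by exists n => //; apply: Hr2; apply: le_trans qr _; rewrite ge_min lexx orbT.
apply: le_trans (HL1 L n0 k c LL1 _); last by move=> q /Hsq[].
have mC : measurable (\bigcap_j V j) by exact: bigcapT_measurable.
apply: le_measure; rewrite ?inE.
- by apply: measurableI => //; exact: measurable_square.
- apply: measurableI; last exact: measurable_square.
  by apply: bigcupT_measurable => i; exact: measurable_failure.
move=> q [Cq sq]; split=> //.
have [_ Wq] : (box M `&` wandering e) q by rewrite -VE.
apply: contrapT => H.
have [sq1 sq2 _] := Hsq q sq.
have start : good a s g L n0 (pt q) n0.
  by split=> //; rewrite /level subnn mulr0 addr0.
have [||N HN] := itinerary_near A_gt0 a_gt0 a_ge a_le s_gt0 s_le g_gt0 g_le1 growth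
  L0 _ start _ e0.
- by move=> x Lx; apply: HL2; exact: le_trans Lx.
- move=> t n0t [gt1 gt2]; rewrite ltNge; apply/negP => H'; apply: H.
  by exists (t - n0)%N => //; rewrite subnKC.
exact: wandering_off e0 Wq HN.
Qed.

Lemma wandering_null e : 0 < e -> mu (wandering e) = 0%E.
Proof.
move=> e0; apply: measure_negligible; first exact: measurable_wandering.
rewrite -[wandering e]setTI -box_cover setI_bigcupl.
apply: negligible_bigcup => M; apply/negligibleP; last exact: wandering_null_box.
by apply: measurableI; [exact: measurable_box|exact: measurable_wandering].
Qed.

End Wandering.

(** * Back to the cylinder *)

Section CylinderOrbit.
Variable R : realType.
Local Notation plane := (measurableTypeR R * measurableTypeR R)%type.
Local Notation mu := (@lebesgue_measure R \x @lebesgue_measure R)%E.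
Local Notation nc := (@Normc.normc R).
Local Notation Re := complex.Re.
Local Notation proj z := (\pi_(cylinder R) z)%qT.

Lemma pi_cylinder0 : proj (0 : R[i]) = 0.
Proof. by rewrite -(subrr 0) pi_cylinderB subrr. Qed.

Lemma orb_periodic (a : nat -> R) n (z : R[i]) (k : int) :
  orb a n.+1 (z + twopi_i R *~ k) = orb a n.+1 z.
Proof. by elim: n => [|n IH]; [rewrite /= /exp_map cexp_periodic|rewrite orbS IH]. Qed.

Lemma random_iter_pi (Omega : Type) (theta : Omega -> Omega) (eta : Omega -> R) w n z :
  random_iter theta eta w n (proj z) =
  proj (orb (fun i => eta (iter i theta w)) n z).
Proof. by elim: n => //= n ->; rewrite cyl_map_pi. Qed.

Lemma cyl_dist_le (z w : R[i]) : cyl_dist (proj z) (proj w) <= nc (z - w).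
Proof.
apply: ge_inf; last by exists z, w.
by exists 0 => r [Z [W [_ _ ->]]]; exact: nc_ge0.
Qed.

Lemma cyl_norm_ge (z : R[i]) : `|Re z| <= cyl_norm (proj z).
Proof.
apply: lb_le_inf; first by exists (nc z), z.
move=> r [Z /eq_cylinderP[k ->] ->]; apply: le_trans (Re_le_nc _).
rewrite ReD; suff -> : Re (twopi_i R *~ k) = 0 by rewrite addr0.
have H (n : nat) : Re (twopi_i R *+ n) = 0.
  by elim: n => [|n IH]; rewrite ?mulr0n// mulrS ReD IH addr0.
case: k => n; first exact: H.
by rewrite NegzE mulrNz -sub0r ReB (H n.+1 : Re (twopi_i R *~ n.+1) = 0) subrr.
Qed.

(** Saturation makes N the full preimage of its image, so measurability and nullity can be read in
    the plane. *)
Lemma cyl_negligible (N : set plane) : measurable N -> mu N = 0%E ->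
  (forall p q : plane, cyl_proj p = cyl_proj q -> N p -> N q) ->
  (@cyl_lebesgue R).-negligible (@cyl_proj R @` N).
Proof.
move=> mN N0 sat.
have pre : @cyl_proj R @^-1` (@cyl_proj R @` N) = N.
  by apply/seteqP; split=> [q [p Np pq]|p Np]; [exact: sat pq Np|exists p].
exists (@cyl_proj R @` N); split=> //.
- by rewrite /measurable /= /cyl_measurable /= pre.
- rewrite /cyl_lebesgue /pushforward pre /mrestr.
  apply: (@subset_measure0 _ _ _ _ _ N) => //.
  by apply: measurableI => //; exact: measurable_strip.
Qed.

End CylinderOrbit.

Lemma limn_esup_nat_infty (R : realType) (k : nat -> nat) :
  (forall n, exists2 m, (n <= m)%N & (n <= k m)%N) ->
  limn_esup (fun n => ((k n)%:R : R)%:E) = +oo%E.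
Proof.
move=> H; rewrite limn_esup_lim.
have -> : esups (fun n => ((k n)%:R : R)%:E) = fun=> +oo%E.
  apply/funext => n /=; apply: eq_infty => t.
  have [m nm km] := H (maxn n (Num.truncn t).+1).
  apply: (@le_trans _ _ ((k m)%:R : R)%:E).
    rewrite lee_fin; apply/ltW; apply: lt_le_trans (truncnS_gt t) _.
    by rewrite ler_nat; apply: leq_trans km; rewrite leq_maxr.
  apply: ereal_sup_ubound; exists m => //=.
  by apply: leq_trans nm; rewrite leq_maxl.
exact: lim_cst.
Qed.

Theorem theorem5 (R : realType) (d : measure_display) (Omega : measurableType d)
    (m : probability Omega R)
    (m_complete : measure_is_complete m)
    (theta theta_inv : Omega -> Omega)
    (thetaK : cancel theta theta_inv) (theta_invK : cancel theta_inv theta)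
    (theta_meas : measurable_fun [set: Omega] theta)
    (theta_inv_meas : measurable_fun [set: Omega] theta_inv)
    (theta_pres : measure_preserving m theta)
    (theta_erg : ergodic m theta)
    (A B : R) (A_gt : (expR 1)^-1 < A) (AB : A < B)
    (eta : Omega -> R) (eta_meas : measurable_fun [set: Omega] eta)
    (eta_bound : forall w, A <= eta w <= B) :
  {ae m, forall w, exists Qw : set (cylinder R),
    (@cyl_lebesgue R).-negligible (~` Qw) /\
    forall z, Qw z ->
      forall delta : R, 0 < delta ->
      exists (N : nat) (k : nat -> nat),
        (forall n : nat, (N <= n)%N ->
           cyl_dist (random_iter theta eta w n z)
             (random_iter theta eta
                (int_iter theta theta_inv (n%:Z - (k n)%:Z) w) (k n) 0) < delta
           \/ delta^-1 <= cyl_norm (random_iter theta eta w n z)) /\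
        limn_esup (fun n => ((k n)%:R : R)%:E) = +oo%E }.
Proof.
apply: aeW => w.
pose a i := eta (iter i theta w).
have a_ge n : A <= a n by have /andP[] := eta_bound (iter n theta w).
have a_le n : a n <= B by have /andP[] := eta_bound (iter n theta w).
have A_gt0 : 0 < A by apply: lt_trans A_gt; rewrite invr_gt0 expR_gt0.
have a_gt0 n : 0 < a n := lt_le_trans A_gt0 (a_ge n).
have [s [g [s_gt0 s_le g_gt0 g_le1 growth]]] := growth_constants A_gt.
have [T T_gt0 sderT] := sder_bound a_gt0 a_ge s_gt0 s_le g_gt0 g_le1 growth.
have e_gt0 i : 0 < (i.+1%:R : R)^-1 by rewrite invr_gt0.
pose bad := bounded_orbit a `|` \bigcup_i wandering a (i.+1%:R)^-1.
have bad_meas : measurable bad.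
  apply: measurableU; first exact: measurable_bounded_orbit.
  by apply: bigcupT_measurable => i; exact: measurable_wandering.
have bad0 : ((@lebesgue_measure R \x @lebesgue_measure R) bad = 0)%E.
  apply: measure_negligible => //; apply: negligibleU.
    apply/negligibleP; first exact: measurable_bounded_orbit.
    exact: (bounded_orbit_null a_gt0 a_ge a_le s_gt0 g_gt0 growth T_gt0 sderT).
  apply: negligible_bigcup => i; apply/negligibleP; first exact: measurable_wandering.
  exact: (wandering_null A_gt0 a_gt0 a_ge a_le s_gt0 s_le g_gt0 g_le1 growth T_gt0 sderT).
(* Orbits of two lifts agree from time 1 on, and badness only concerns late times; hence the shifts
   to [N.+1] and [j.+1]. *)
have sat p q : cyl_proj p = cyl_proj q -> bad p -> bad q.
  move=> /eq_cylinderP[k pq].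
  have orbE n : (0 < n)%N -> orb a n (pt p) = orb a n (pt q).
    by case: n => // n _; rewrite [pt p]pq orb_periodic.
  move=> [[L _ [N _ H]]|[i _ H]]; [left|right].
    exists L => //; exists N.+1 => // n Nn; rewrite -orbE; last exact: leq_trans Nn.
    by apply: H; exact: ltnW.
  exists i => // j _; have [n jn [H1 H2]] := H j.+1 I; exists n; first exact: ltnW.
  have n0 : (0 < n)%N by exact: leq_trans jn.
  by split; [rewrite -orbE|move=> k' kn; rewrite -orbE//; exact: H2].
exists (~` (@cyl_proj R @` bad)); split.
  by rewrite setCK; exact: cyl_negligible.
move=> q; rewrite -[q]reprK; move: (repr q) => {q} z Hz delta delta0.
pose p : measurableTypeR R * measurableTypeR R := (complex.Re z, complex.Im z).
have pE : pt p = z by rewrite /p /pt; case: (z).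
have nbad : ~ bad p by move=> bp; apply: Hz; exists p => //; rewrite -[in RHS]pE.
pose F n := random_iter theta eta w n (\pi_(cylinder R) z)%qT.
pose P n k := cyl_dist (F n) (random_iter theta eta
    (int_iter theta theta_inv (n%:Z - k%:Z) w) k 0) < delta \/ delta^-1 <= cyl_norm (F n).
have [N HN] : exists N, forall n, (N <= n)%N -> exists k, P n k.
  (* Half of [delta] turns the large inequality of [near_postsingular] into a strict one. *)
  pose i := Num.truncn (2 / delta).
  have id2 : (i.+1%:R : R)^-1 <= delta / 2.
    rewrite -[leRHS]invrK lef_pV2 ?posrE ?invr_gt0 ?divr_gt0// invf_div.
    by apply: ltW; rewrite /i; exact: truncnS_gt.
  have [N HN] : exists N, forall n, (N <= n)%N -> near_postsingular a (i.+1%:R)^-1 n z.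
    apply: contrapT => H; apply: nbad; right; exists i => // j _.
    apply: contrapT => H'; apply: H; exists j => n jn.
    apply: contrapT => H; apply: H'; exists n => //.
    by apply/off_postsingularP; rewrite pE.
  exists N => n /HN[H|[k kn H]].
    exists 0%N; right; rewrite /F random_iter_pi.
    apply: le_trans (cyl_norm_ge _); apply: le_trans H.
    by rewrite lef_pV2 ?posrE//; apply: le_trans id2 _; lra.
  exists k; left; rewrite /F.
  have -> : int_iter theta theta_inv (n%:Z - k%:Z) w = iter (n - k) theta w.
    by rewrite subzn.
  rewrite -pi_cylinder0 !random_iter_pi; apply: le_lt_trans (cyl_dist_le _ _) _.
  have -> : (fun j => eta (iter j theta (iter (n - k) theta w))) = shift a (n - k).
    by apply/funext => j; rewrite /shift /a addnC iterD.
  by apply: le_lt_trans H _; apply: le_lt_trans id2 _; lra.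
(* When the orbit is far away every k is allowed, and k = n is chosen. As the real part exceeds
   1/delta infinitely often, this makes the limsup of k infinite. *)
have HP n : exists k, (N <= n)%N -> P n k /\ (delta^-1 <= cyl_norm (F n) -> k = n).
  have [far|close] := leP delta^-1 (cyl_norm (F n)).
    by exists n => _; split=> //; right.
  have [Nn|nN] := boolP (N <= n)%N; last by exists 0%N.
  have [k Pk] := HN n Nn; by exists k.
have [k Hk] := choice HP.
exists N, k; split; first by move=> n /Hk[].
apply: limn_esup_nat_infty => n.
have [n' nn' far] : exists2 n', (maxn n N <= n')%N & delta^-1 <= complex.Re (orb a n' z).
  apply: contrapT => H; apply: nbad; left; exists (Num.truncn delta^-1).+1 => //.
  exists (maxn n N) => // n' nn'; apply/ltW; apply: lt_trans (truncnS_gt delta^-1).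
  by rewrite ltNge pE; apply/negP => far; apply: H; exists n'.
rewrite geq_max in nn'; have /andP[nn Nn] := nn'.
exists n' => //; have [_ ->//] := Hk n' Nn.
rewrite /F random_iter_pi; apply: le_trans (cyl_norm_ge _).
by apply: le_trans (ler_norm _).
Qed.
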